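(* Let $p\ge 2$ be an integer. For every $k=\pm(p-1)^i$ with $i\in\mathbb{N}$, the Watatani index of $\chi_k(\mathcal{Q}_p)$ in $\mathcal{Q}_p$ is equal to $|k|$.
   Context: For an integer $p\ge 2$, the $p$-adic ring $C^*$-algebra $\mathcal{Q}_p$ is the universal $C^*$-algebra generated by a unitary $U$ and an isometry $S_p$ such that $S_pU=U^pS_p$ and $\sum_{l=0}^{p-1}U^lS_pS_p^*U^{-l}=1$. For an integer $k$ coprime with $p$, $\chi_k:\mathcal{Q}_p\to\mathcal{Q}_p$ is the unital $*$-endomorphism with $\chi_k(U)=U^k$, $\chi_k(S_p)=S_p$. Watatani index. Let $\mathcal{A}\subset\mathcal{B}$ be an inclusion of unital $C^*$-algebras with common unit and $E:\mathcal{B}\to\mathcal{A}$ a faithful conditional expectation. A finite family $\{u_1,\dots,u_n\}\subset\mathcal{B}$ is a quasi-basis for $E$ if $x=\sum_{i=1}^n u_iE(u_i^*x)=\sum_{i=1}^nE(xu_i)u_i^*$ for all $x\in\mathcal{B}$. $E$ has finite index if it admits a quasi-basis, and then $\mathrm{Ind}(E):=\sum_{i=1}^nu_iu_i^*$, which does not depend on the quasi-basis and lies in the center of $\mathcal{B}$; if $\mathcal{B}$ has trivial center it is a real number $\ge 1$. The Watatani index of $\mathcal{A}$ in $\mathcal{B}$ is the infimum of $\mathrm{Ind}(E)$ over all conditional expectations $E:\mathcal{B}\to\mathcal{A}$ of finite index. *)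

(* Defs.v *)
From HB Require Import structures.
From mathcomp Require Import all_boot all_order all_algebra.
From mathcomp Require Import complex.
From mathcomp Require Import all_classical all_reals all_analysis.

Set Implicit Arguments.
Unset Strict Implicit.
Unset Printing Implicit Defensive.

Import Order.TTheory GRing.Theory Num.Theory.
Import numFieldNormedType.Exports.

Local Open Scope classical_set_scope.
Local Open Scope ring_scope.

(** Unital C*-algebras over [R[i]].  The underlying [algType] has [1 != 0].
    [normedModType] cannot be joined with [algType] outside the library
    ([numDomainType] already inherits from both), so the real-valued norm
    [cnorm], its completeness and its convergence are stated explicitly. *)
HB.mixin Record Algebra_isCStar (R : realType) A & GRing.Algebra R[i] A := {
  star : A -> A;
  starK : forall x : A, star (star x) = x;
  starD : forall x y : A, star (x + y) = star x + star y;
  starZ : forall (c : R[i]) (x : A), star (c *: x) = Num.conj c *: star x;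
  starM : forall x y : A, star (x * y) = star y * star x;
  cnorm : A -> R;
  cnorm0_eq0 : forall x : A, cnorm x = 0 -> x = 0;
  ler_cnormD : forall x y : A, cnorm (x + y) <= cnorm x + cnorm y;
  cnormZ : forall (c : R[i]) (x : A), cnorm (c *: x) = Normc.normc c * cnorm x;
  ler_cnormM : forall x y : A, cnorm (x * y) <= cnorm x * cnorm y;
  cnorm_star_mul : forall x : A, cnorm (star x * x) = cnorm x ^+ 2;
  cnorm_complete : forall u : nat -> A,
    (forall e : R, 0 < e -> exists N, forall m n, (N <= m)%N -> (N <= n)%N ->
       cnorm (u m - u n) < e) ->
    exists l : A, (fun n => cnorm (u n - l)) @ \oo --> (0 : R)
}.

#[short(type="cstarType")]
HB.structure Definition CStar (R : realType) :=
  { A of GRing.Algebra R[i] A & Algebra_isCStar R A }.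

Section CStarTheory.
Context {R : realType}.
Implicit Types A B : cstarType R.

Definition star_hom A B (f : A -> B) : Prop :=
  [/\ linear f, f 1 = 1, forall x y, f (x * y) = f x * f y
    & forall x, f (star x) = star (f x)].

Definition unital_cstar_subalgebra A (D : set A) : Prop :=
  [/\ D 1, forall (c : R[i]) x y, D x -> D y -> D (c *: x + y),
      forall x y, D x -> D y -> D (x * y), forall x, D x -> D (star x)
    & forall (u : nat -> A) (l : A), (forall n, D (u n)) ->
        (fun n => cnorm (u n - l)) @ \oo --> (0 : R) -> D l].

Definition is_unitary A (u : A) : Prop := star u * u = 1 /\ u * star u = 1.

Definition is_isometry A (s : A) : Prop := star s * s = 1.

(** Integer powers of a unitary, whose inverse is its adjoint. *)
Definition upow A (u : A) (k : int) : A :=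
  match k with Posz n => u ^+ n | Negz n => star u ^+ n.+1 end.

Definition Qp_relations (p : nat) A (u s : A) : Prop :=
  [/\ is_unitary u, is_isometry s, s * u = u ^+ p * s
    & \sum_(l < p) u ^+ l * s * star s * upow u (- l%:Z) = 1].

(** [Q] is the universal C*-algebra generated by elements [U] and [S] subject
    to the relations of the p-adic ring C*-algebra. *)
Definition is_Qp (p : nat) (Q : cstarType R) (U S : Q) : Prop :=
  [/\ Qp_relations p U S,
      forall D : set Q, unital_cstar_subalgebra D -> D U -> D S -> D = setT
    & forall (B : cstarType R) (u s : B), Qp_relations p u s ->
        exists! f : Q -> B, [/\ star_hom f, f U = u & f S = s]].

Definition is_chi (Q : cstarType R) (U S : Q) (k : int) (chi : Q -> Q) : Prop :=
  [/\ star_hom chi, chi U = upow U k & chi S = S].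

Definition is_positive B (x : B) : Prop := exists y : B, x = star y * y.

(** Faithful conditional expectations of [B] onto a C*-subalgebra [A], seen as
    maps from [B] to itself with values in [A]. *)
Definition faithful_cond_exp B (A : set B) (E : B -> B) : Prop :=
  [/\ linear E,
      (forall x, A (E x)) /\ (forall a, A a -> E a = a),
      forall a x b, A a -> A b -> E (a * x * b) = a * E x * b,
      forall x, is_positive x -> is_positive (E x)
    & forall x, E (star x * x) = 0 -> x = 0].

Definition quasi_basis B (E : B -> B) n (u : 'I_n -> B) : Prop :=
  forall x : B,
    x = \sum_(i < n) u i * E (star (u i) * x) /\
    x = \sum_(i < n) E (x * u i) * star (u i).

(** [E] has finite index, and [Ind E = b]. *)
Definition has_index B (E : B -> B) (b : B) : Prop :=
  exists n (u : 'I_n -> B),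
    quasi_basis E u /\ b = \sum_(i < n) u i * star (u i).

Lemma has_index_unique B (E : B -> B) (b c : B) :
  has_index E b -> has_index E c -> b = c.
Proof.
move=> [n [u [qu ->]]] [m [v [qv ->]]].
transitivity (\sum_(i < n) \sum_(j < m)
    v j * E (star (v j) * u i) * star (u i)).
  by apply: eq_bigr => i _; rewrite {1}(proj1 (qv (u i))) mulr_suml.
rewrite exchange_big /=; apply: eq_bigr => j _.
rewrite {2}(proj2 (qu (star (v j)))) mulr_sumr.
by apply: eq_bigr => i _; rewrite mulrA.
Qed.

(** The infimum of the [Ind E] for the algebras [B] with trivial center, where
    [Ind E] is a real multiple [r] of [1]; it is [+oo] when no conditional
    expectation onto [A] has finite index. *)
Definition watatani_index B (A : set B) : \bar R :=
  ereal_inf [set r%:E | r in [set r : R | exists E : B -> B,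
    faithful_cond_exp A E /\ has_index E (real_complex R r *: 1)]].

End CStarTheory.

(* Main.v *)
Require Import Defs.
From mathcomp Require Import all_boot all_order all_algebra.
From mathcomp Require Import complex.
From mathcomp Require Import all_classical all_reals all_analysis.
From mathcomp Require Import ring lra zify.

(** Let the algebra [Q] act on the square-summable sequences indexed by the
    integers, [U] being the shift by 1 and [S] the dilation by [p].  Composing
    [chi] with the flip [U |-> star U], an involution of [Q], turns a negative [k]
    into a positive one with the same range; so let [k] be positive and coprime
    to [p].

    An expectation of index [k].  On the multiples of [k], the shift by [k] and
    the dilation by [p] are a copy of [U] and [S], so compressing to these
    multiples should undo [chi].  This is carried out inside [Q].  When
    [k <= p ^ n], the isometries [U ^+ r * S ^+ n] with [r < p ^ n] identify [Q]
    with the matrices of size [p ^ n] over [Q], and on [k] of these coordinates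
    the generator [U] acquires a [k]-th root ([root_unitary]) which, with a
    companion isometry, again satisfies the defining relations
    ([root_relations]).  The universal property gives an endomorphism [rho], and
    its compression [untwist] to the zeroth coordinate is a left inverse of
    [chi] ([chiK]).  The map [twisted_exp = chi \o untwist] is a faithful
    conditional expectation, for which the [U ^+ j] with [j < k] form a
    quasi-basis ([twisted_expansion]); its index is [k].  Both facts say that
    some operator intertwines two homomorphisms, and [star_hom_intertwine]
    reduces this to the generators by the uniqueness half of the universal
    property.

    There is no other expectation.  By the module property and the quasi-basis,
    it suffices that every expectation [F] kills [U ^+ j] when [k] does not
    divide [j] ([cond_exp_UX]).  Write [F (U ^+ j) = chi x].  Then [x] commutes
    with [U] and permutes the cylinder projections like the translation by the
    [p]-adic number [j / k].  But [Q] is the closed span of monomials in [U], [S] and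
    their adjoints, which act by affine maps with coefficients in [Z[1/p]], and
    such a map agrees with the translation by [j / k] in at most one point.  So
    [x] is arbitrarily small on some cylinder, hence on all its translates,
    hence everywhere ([fractional_translation_eq0]).  The expectation being
    unique, the infimum that defines the Watatani index is over the single
    value [k].

    The algebra starts from the orthogonality of the ranges of the
    [U ^+ l * S], [l < p], which holds because projections with sum [1] are
    orthogonal.  This rests on the extremality of [1] in the unit ball
    ([one_extreme]). *)

Set Implicit Arguments.
Unset Strict Implicit.
Unset Printing Implicit Defensive.

Import Order.TTheory GRing.Theory Num.Theory.

Local Open Scope classical_set_scope.
Local Open Scope ring_scope.

(** * Sums over residue classes *)

Lemma sum_mul (V : nmodType) (F : nat -> V) m n :
  \sum_(i < m * n) F i = \sum_(i < m) \sum_(j < n) F (i * n + j)%N.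
Proof.
rewrite -(big_mkord xpredT F) big_nat_mul big_mkord; apply: eq_bigr => i _.
rewrite -{1}[(i * n)%N]add0n big_addn mulSn addnK big_mkord.
by apply: eq_bigr => j _; rewrite addnC.
Qed.

Lemma eqn_modMl_coprime k a i j : coprime k a ->
  (a * i == a * j %[mod k])%N = (i == j %[mod k])%N.
Proof.
move=> ka; wlog ij : i j / (j <= i)%N => [H|].
  by have [/H|/ltnW/H h] := leqP j i; last by rewrite eq_sym h eq_sym.
by rewrite !eqn_mod_dvd ?leq_mul2l ?ij ?orbT // -mulnBr Gauss_dvdr.
Qed.

(** Multiplication by [a] followed by translation by [b] permutes the residues
    modulo [k]. *)
Lemma sum_periodic (V : nmodType) (F : nat -> V) k a b : coprime k a ->
  (forall t, F (t + k)%N = F t) ->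
  \sum_(j < k) F (a * j + b)%N = \sum_(j < k) F j.
Proof.
move=> ka Fk; case: k ka Fk => [|k] ka Fk; first by rewrite !big_ord0.
have Fmod t : F (t %% k.+1)%N = F t.
  rewrite [in RHS](divn_eq t k.+1) addnC.
  elim: (t %/ k.+1)%N => [|q ->]; first by rewrite mul0n addn0.
  by rewrite mulSnr addnA Fk.
pose h (j : 'I_k.+1) : 'I_k.+1 := inord ((a * j + b) %% k.+1).
have hE j : h j = ((a * j + b) %% k.+1)%N :> nat by rewrite inordK // ltn_mod.
rewrite [RHS](reindex_inj (h := h)).
  by apply: eq_bigr => j _; rewrite hE Fmod.
move=> i j /(congr1 val); rewrite /= !hE => /eqP.
by rewrite eqn_modDr eqn_modMl_coprime // !modn_small // => /eqP/val_inj.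
Qed.

(** * Norm and positivity in C*-algebras *)

Lemma parallelogram_one (T : comNzRingType) (A : nzRingType)
    (f : {rmorphism T -> A}) (X : T) :
  (1 + f X * f X) *+ 2 = (1 + f X) ^+ 2 + (1 - f X) ^+ 2.
Proof.
have /(congr1 f) : (1 + X * X) *+ 2 = (1 + X) ^+ 2 + (1 - X) ^+ 2 by ring.
by rewrite !(rmorphMn, rmorphXn, rmorphM, rmorphD, rmorphN, rmorph1).
Qed.

(** With [J] a square root of [-1], this writes [1 + 2 X] as the convex combination
    of [(1 + X)^4], [(1 + X)^3 (1 - X)], [(1 + J X)^4] and [(1 - J X)^4] with
    weights 1/4, 1/2, 1/8, 1/8, in which the terms of degree at least 2 cancel. *)
Lemma double_as_mean (T : comNzRingType) (A : nzRingType)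
    (f : {rmorphism T -> A}) (J X : T) : J * J = -1 ->
  (1 + f X *+ 2) *+ 8 =
  (1 + f X) ^+ 4 *+ 2 + (1 + f X) ^+ 3 * (1 - f X) *+ 4
  + ((1 + f J * f X) ^+ 4 + (1 - f J * f X) ^+ 4).
Proof.
move=> JJ.
have /(congr1 f) : (1 + X *+ 2) *+ 8 =
    (1 + X) ^+ 4 *+ 2 + (1 + X) ^+ 3 * (1 - X) *+ 4
    + ((1 + J * X) ^+ 4 + (1 - J * X) ^+ 4).
  apply/eqP; rewrite -subr_eq0; apply/eqP.
  transitivity ((J * J + 1) * (- (X * X *+ 12) - (J * J - 1) * (X ^+ 4) *+ 2)).
    by ring.
  by rewrite JJ addNr mul0r.
by rewrite !(rmorphMn, rmorphXn, rmorphM, rmorphD, rmorphN, rmorph1).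
Qed.

Section CStarBasics.
Context {R : realType} {A : cstarType R}.
Implicit Types (x y b h q : A) (c : R[i]).

Lemma star0 : star (0 : A) = 0.
Proof. by apply: (@addrI _ (star (0 : A))); rewrite -starD !addr0. Qed.

Lemma star_sum (I : Type) (r : seq I) (P : pred I) (F : I -> A) :
  star (\sum_(i <- r | P i) F i) = \sum_(i <- r | P i) star (F i).
Proof. exact: (big_morph _ (@starD _ A) star0). Qed.

Lemma star1 : star (1 : A) = 1.
Proof. by rewrite -[LHS]mulr1 -{2}(starK (1 : A)) -starM mulr1 starK. Qed.

Lemma starN x : star (- x) = - star x.
Proof. by apply: (@addrI _ (star x)); rewrite -starD !subrr star0. Qed.

Lemma starB x y : star (x - y) = star x - star y.
Proof. by rewrite starD starN. Qed.

Lemma starX x n : star (x ^+ n) = star x ^+ n.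
Proof.
by elim: n => [|n IH]; rewrite ?expr0 ?star1 // exprS starM IH -exprSr.
Qed.

Lemma starMn x n : star (x *+ n) = star x *+ n.
Proof. by elim: n => [|n IH]; rewrite ?mulr0n ?star0 // !mulrS starD IH. Qed.

Lemma isometryX (v : A) n : star v * v = 1 -> star v ^+ n * v ^+ n = 1.
Proof.
move=> vv; elim: n => [|n IH]; first by rewrite !expr0 mul1r.
by rewrite exprSr exprS mulrA -[_ * _ * v]mulrA vv mulr1 IH.
Qed.

Lemma cnorm0 : cnorm (0 : A) = 0.
Proof. by rewrite -(scale0r (0 : A)) cnormZ Normc.normc0 mul0r. Qed.

Lemma normc_real (r : R) : Normc.normc (real_complex R r) = `|r|.
Proof. by rewrite /= expr0n addr0 sqrtr_sqr. Qed.

Lemma cnormN x : cnorm (- x) = cnorm x.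
Proof. by rewrite -scaleN1r -(rmorphN1 (real_complex R)) cnormZ normc_real normrN1 mul1r. Qed.

Lemma cnorm_ge0 x : 0 <= cnorm x.
Proof.
have := ler_cnormD x (- x); rewrite subrr cnorm0 cnormN -mulr2n.
by rewrite pmulrn_lge0.
Qed.

Lemma cnormMn x n : cnorm (x *+ n) = cnorm x *+ n.
Proof.
by rewrite -scaler_nat -(rmorph_nat (real_complex R)) cnormZ normc_real normr_nat mulr_natl.
Qed.

Lemma ler_cnorm_sum (I : Type) (r : seq I) (P : pred I) (F : I -> A) :
  cnorm (\sum_(i <- r | P i) F i) <= \sum_(i <- r | P i) cnorm (F i).
Proof.
elim/big_ind2: _ => [|x u y v xu yv|//]; first by rewrite cnorm0.
exact: le_trans (ler_cnormD _ _) (lerD xu yv).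
Qed.

Lemma cnorm_star x : cnorm (star x) = cnorm x.
Proof.
have le_star y : cnorm y <= cnorm (star y).
  have [->|ny0] := eqVneq (cnorm y) 0; first exact: cnorm_ge0.
  have ny : 0 < cnorm y by rewrite lt_neqAle eq_sym ny0 cnorm_ge0.
  by rewrite -(ler_pM2r ny) -expr2 -cnorm_star_mul ler_cnormM.
by apply/le_anti; rewrite le_star -{2}(starK x) le_star.
Qed.

Lemma cstar_eq0 x : star x * x = 0 -> x = 0.
Proof.
move=> xx; apply: cnorm0_eq0; apply/eqP.
by rewrite -sqrf_eq0 -cnorm_star_mul xx cnorm0.
Qed.

Lemma cnorm_isometry x : star x * x = 1 -> cnorm x <= 1.
Proof.
move=> xx; have := cnorm_star_mul x; rewrite xx => n1.
have : cnorm (1 : A) = cnorm (1 : A) ^+ 2.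
  by rewrite -cnorm_star_mul star1 mulr1.
rewrite n1 => n2; rewrite -(@expr_le1 _ 2) ?cnorm_ge0 //.
by have := sqr_ge0 (cnorm x); nra.
Qed.

Lemma cnorm1_le : cnorm (1 : A) <= 1.
Proof. by apply: cnorm_isometry; rewrite star1 mulr1. Qed.

Lemma cnorm_projection q : star q = q -> q * q = q -> cnorm q <= 1.
Proof.
move=> qs qq; have := cnorm_star_mul q; rewrite qs qq => n1.
by have := cnorm_ge0 q; nra.
Qed.

Lemma cnorm_mul_le1 x y : cnorm x <= 1 -> cnorm y <= 1 -> cnorm (x * y) <= 1.
Proof.
move=> nx ny; apply: le_trans (ler_cnormM _ _) _.
by rewrite mulr_ile1 // cnorm_ge0.
Qed.

Lemma cnorm_exp_le1 x n : cnorm x <= 1 -> cnorm (x ^+ n) <= 1.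
Proof.
move=> nx; elim: n => [|n IH]; first by rewrite expr0 cnorm1_le.
by rewrite exprS cnorm_mul_le1.
Qed.

(** By the C*-identity [|1 + i b|^2 = |1 + b^2|], and [1 + b^2] is the mean of
    [(1 + b)^2] and [(1 - b)^2]; so [1 + i b] and [1 - i b] are contractions as
    well, and [double_as_mean] presents [1 + 2 b] as a mean of contractions. *)
Lemma one_extreme_double b : star b = b ->
  cnorm (1 + b) <= 1 -> cnorm (1 - b) <= 1 -> cnorm (1 + b *+ 2) <= 1.
Proof.
move=> bs nD nB.
have sqD : cnorm (1 + b * b) <= 1.
  have := parallelogram_one (horner_alg b) 'X; rewrite /= horner_algX => E.
  have := cnormMn (1 + b * b) 2; rewrite E => n2.
  have := ler_cnormD ((1 + b) ^+ 2) ((1 - b) ^+ 2).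
  have := cnorm_exp_le1 2 nD; have := cnorm_exp_le1 2 nB.
  by rewrite n2; lra.
have ni (j : R[i]) : j ^+ 2 = -1 -> Num.conj j = - j -> cnorm (1 + j *: b) <= 1.
  move=> jj cj; have := cnorm_star_mul (1 + j *: b).
  rewrite starD star1 starZ bs cj mulrDl mul1r -scalerAl mulrDr mulr1 -scalerAr.
  rewrite scalerDr [- j *: b]scaleNr addrA addrK scalerA mulNr -expr2 jj opprK.
  by rewrite scale1r => n2; have := cnorm_ge0 (1 + j *: b); nra.
have n1 := ni 'i (sqrCi _) (conjCi _).
have n2 : cnorm (1 - 'i *: b) <= 1.
  by rewrite -scaleNr ni ?sqrrN ?sqrCi // rmorphN /= conjCi.
have JJ : 'i%:P * 'i%:P = -1 :> {poly R[i]}.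
  by rewrite -polyCM -expr2 sqrCi polyCN.
have := double_as_mean (horner_alg b) 'X JJ.
rewrite /= horner_algX horner_algC mulr_algl => E.
have := cnormMn (1 + b *+ 2) 8; rewrite E => nE.
set P4 := (1 + b) ^+ 4 in nE; set P31 := (1 + b) ^+ 3 * (1 - b) in nE.
set I1 := (1 + 'i *: b) ^+ 4 in nE; set I2 := (1 - 'i *: b) ^+ 4 in nE.
have := ler_cnormD (P4 *+ 2 + P31 *+ 4) (I1 + I2).
have := ler_cnormD (P4 *+ 2) (P31 *+ 4); have := ler_cnormD I1 I2.
rewrite !cnormMn nE.
have : cnorm P4 <= 1 by apply: cnorm_exp_le1.
have : cnorm P31 <= 1 by apply: cnorm_mul_le1 => //; apply: cnorm_exp_le1.
have : cnorm I1 <= 1 by apply: cnorm_exp_le1.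
have : cnorm I2 <= 1 by apply: cnorm_exp_le1.
by lra.
Qed.

(** The unit is an extreme point of the unit ball: [one_extreme_double] can
    be iterated, and [1 + 2^n b] stays bounded only if [b = 0]. *)
Lemma one_extreme b : star b = b ->
  cnorm (1 + b) <= 1 -> cnorm (1 - b) <= 1 -> b = 0.
Proof.
move=> bs nD nB.
have H n : cnorm (1 + b *+ (2 ^ n)) <= 1 /\ cnorm (1 - b *+ (2 ^ n)) <= 1.
  elim: n => [|n [IH1 IH2]]; first by rewrite mulr1n.
  rewrite expnSr mulrnA; split.
    by apply: one_extreme_double; rewrite ?starMn ?bs.
  by rewrite -mulNrn; apply: one_extreme_double; rewrite ?starN ?starMn ?bs ?opprK.
apply: cnorm0_eq0; apply/eqP; apply: contraT => nb0.
have nb : 0 < cnorm b by rewrite lt_neqAle eq_sym nb0 cnorm_ge0.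
have bnd n : cnorm b *+ n <= 2.
  have : cnorm b *+ (2 ^ n) <= 2.
    rewrite -cnormMn; have [h1 _] := H n.
    have := ler_cnormD (1 + b *+ (2 ^ n)) (- 1).
    by rewrite addrAC subrr add0r cnormN; have := cnorm1_le; lra.
  by apply: le_trans; apply: ler_wpMn2l (ltnW (ltn_expl _ _)); rewrite ?ltW.
set m := Num.bound (2 / cnorm b).
have m_big : 2 / cnorm b < m%:R by apply: archi_boundP; rewrite divr_ge0 // ltW.
have := bnd m; rewrite -[_ *+ m]mulr_natl leNgt -ltr_pdivrMr //.
by rewrite m_big.
Qed.

(** A self-adjoint [b] with [|1 - b| <= 1] is positive, so these are positive
    elements with sum zero.  Spectral theory is avoided: [b i] is minus the sum
    of the other terms, so both [1 + b i / n] and [1 - b i / n] are contractions,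
    and [one_extreme] applies. *)
Lemma sum_positive_eq0 n (b : 'I_n -> A) :
  (forall i, star (b i) = b i) -> (forall i, cnorm (1 - b i) <= 1) ->
  \sum_(i < n) b i = 0 -> forall i, b i = 0.
Proof.
move=> bs nb sb i; case: n b bs nb sb i => [|n] b bs nb sb i; first by case: i.
have n0 : (n.+1%:R : R[i]) != 0 by rewrite pnatr_eq0.
have n1' : (0 : R) < n.+1%:R by rewrite ltr0n.
(* Rescaling by [n + 1], the number of terms, turns bounds by [n + 1] into bounds
   by [1]. *)
have scale (x : A) : cnorm (n.+1%:R *: 1 + x) <= n.+1%:R ->
    cnorm (1 + n.+1%:R^-1 *: x) <= 1.
  move=> nx; rewrite -(ler_pM2l n1') mulr1 (mulr_natl _ n.+1) -cnormMn.
  by rewrite -scaler_nat scalerDr scalerA mulfV // scale1r.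
suff : n.+1%:R^-1 *: b i = 0.
  by move/(congr1 ( *:%R n.+1%:R)); rewrite scalerA mulfV // scale1r scaler0.
apply: one_extreme; first by rewrite starZ bs fmorphV /= conjC_nat.
  apply: scale.
  have -> : n.+1%:R *: 1 + b i = \sum_(j < n.+1 | j != i) (1 - b j) + 1.
    have := sb; rewrite (bigD1 i) //= => /eqP; rewrite addr_eq0 => /eqP ->.
    rewrite scaler_nat mulrS -addrA addrC; congr (_ + 1).
    rewrite big_split /= sumrN sumr_const; congr (_ *+ _ - _).
    by rewrite -[LHS]/(n.+1.-1) -{1}(card_ord n.+1) -(cardC1 i).
  apply: le_trans (ler_cnormD _ _) _.
  rewrite [leRHS]mulrSr; apply: lerD; last exact: cnorm1_le.
  apply: le_trans (ler_cnorm_sum _ _ _) _.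
  apply: le_trans (ler_sum _ (fun j _ => nb j)) _.
  rewrite sumr_const ler_nat.
  by rewrite -[leqRHS]/(n.+1.-1) -[in leqRHS](card_ord n.+1) -(cardC1 i).
rewrite -scalerN; apply: scale.
have -> : n.+1%:R *: 1 - b i = 1 *+ n + (1 - b i).
  by rewrite scaler_nat mulrSr addrA.
apply: le_trans (ler_cnormD _ _) _; rewrite [leRHS]mulrSr; apply: lerD (nb i).
by rewrite cnormMn ler_wMn2r ?cnorm1_le.
Qed.

End CStarBasics.

(** * Star-homomorphisms and the defining relations *)

Section StarHom.
Context {R : realType} {A B : cstarType R} (f : A -> B).
Hypothesis hf : star_hom f.

Lemma star_hom_lin (c : R[i]) x y : f (c *: x + y) = c *: f x + f y.
Proof. by case: hf => + _ _ _; exact. Qed.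

Lemma star_hom1 : f 1 = 1. Proof. by case: hf. Qed.

Lemma star_homM x y : f (x * y) = f x * f y. Proof. by case: hf. Qed.

Lemma star_hom_star x : f (star x) = star (f x). Proof. by case: hf. Qed.

Lemma star_homD x y : f (x + y) = f x + f y.
Proof. by rewrite -{1}[x]scale1r star_hom_lin scale1r. Qed.

Lemma star_hom0 : f 0 = 0.
Proof. by apply: (@addrI _ (f 0)); rewrite -star_homD !addr0. Qed.

Lemma star_homX x n : f (x ^+ n) = f x ^+ n.
Proof.
by elim: n => [|n IH]; rewrite ?expr0 ?star_hom1 // !exprS star_homM IH.
Qed.

Lemma star_hom_sum (I : Type) (r : seq I) (P : pred I) (F : I -> A) :
  f (\sum_(i <- r | P i) F i) = \sum_(i <- r | P i) f (F i).
Proof. exact: (big_morph _ star_homD star_hom0). Qed.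

End StarHom.

Lemma star_hom_comp {R : realType} {A B C : cstarType R}
    (f : A -> B) (g : B -> C) :
  star_hom f -> star_hom g -> star_hom (g \o f).
Proof.
move=> hf hg; split => [c x y||x y|x] /=.
- by rewrite (star_hom_lin hf) (star_hom_lin hg).
- by rewrite (star_hom1 hf) (star_hom1 hg).
- by rewrite (star_homM hf) (star_homM hg).
- by rewrite (star_hom_star hf) (star_hom_star hg).
Qed.

Section Relations.
Context {R : realType} {A : cstarType R} (p : nat).

Lemma upowN (u : A) n : upow u (- n%:Z) = star u ^+ n.
Proof. by case: n => [|n] //=; rewrite expr0. Qed.

Lemma Qp_relationsE (u s : A) : Qp_relations p u s <->
  [/\ star u * u = 1, u * star u = 1, star s * s = 1, s * u = u ^+ p * s
    & \sum_(l < p) u ^+ l * s * star s * star u ^+ l = 1].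
Proof.
have E : \sum_(l < p) u ^+ l * s * star s * upow u (- l%:Z) =
         \sum_(l < p) u ^+ l * s * star s * star u ^+ l.
  by apply: eq_bigr => l _; rewrite upowN.
split=> [[[uu1 uu2] ss su]|[uu1 uu2 ss su sum1]]; first by rewrite E.
by split; rewrite ?E.
Qed.

End Relations.

Lemma Qp_relations_hom {R : realType} {A B : cstarType R} p (u s : A)
    (f : A -> B) :
  star_hom f -> Qp_relations p u s -> Qp_relations p (f u) (f s).
Proof.
move=> hf /Qp_relationsE [uu1 uu2 ss su sum1]; apply/Qp_relationsE; split.
- by rewrite -(star_hom_star hf) -(star_homM hf) uu1 (star_hom1 hf).
- by rewrite -(star_hom_star hf) -(star_homM hf) uu2 (star_hom1 hf).
- by rewrite -(star_hom_star hf) -(star_homM hf) ss (star_hom1 hf).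
- by rewrite -(star_homX hf) -!(star_homM hf) su.
rewrite -[RHS](star_hom1 hf) -[in RHS]sum1 (star_hom_sum hf).
by apply: eq_bigr => l _; rewrite !(star_homM hf, star_homX hf, star_hom_star hf).
Qed.

(** * Cylinder projections *)

Section Cylinders.
Context {R : realType} {A : cstarType R} (p : nat) (U S : A).
Hypothesis hp : (2 <= p)%N.
Hypothesis hrel : Qp_relations p U S.

Lemma starUXU n : star U ^+ n * U ^+ n = 1.
Proof. by apply: isometryX; case/Qp_relationsE: hrel. Qed.

Lemma UXstarU n : U ^+ n * star U ^+ n = 1.
Proof.
have [_ UU _ _ _] := (Qp_relationsE p U S).1 hrel.
by rewrite -{1}(starK U) isometryX // starK.
Qed.

Lemma starSXS n : star S ^+ n * S ^+ n = 1.
Proof. by apply: isometryX; case/Qp_relationsE: hrel. Qed.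

Lemma S_UX n : S * U ^+ n = U ^+ (p * n) * S.
Proof.
have [_ _ _ SU _] := (Qp_relationsE p U S).1 hrel.
elim: n => [|n IH]; first by rewrite muln0 !expr0 mulr1 mul1r.
by rewrite exprSr mulrA IH -mulrA SU mulrA -exprD mulnSr.
Qed.

Lemma SX_UX m n : S ^+ m * U ^+ n = U ^+ (p ^ m * n) * S ^+ m.
Proof.
elim: m => [|m IH]; first by rewrite expr0 mul1n mul1r mulr1.
by rewrite exprS -mulrA IH mulrA S_UX -mulrA mulnA expnS.
Qed.

(** The projections onto the ranges of the [U ^+ l * S], [l < p], sum to [1].
    Compressing by [S], the range of which is the first of them, leaves a
    vanishing sum of positive elements, one of which is [a * star a] for
    [a = star S * U ^+ l * S]. *)
Lemma starS_UX_S_eq0 l : (0 < l < p)%N -> star S * U ^+ l * S = 0.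
Proof.
move=> /andP[l0 lp].
have [UU1 UU2 SS SU sum1] := (Qp_relationsE p U S).1 hrel.
case: p hp lp sum1 => [|q] // _ lq sum1.
pose P j := U ^+ j * S * star S * star U ^+ j.
have Ps j : star (P j) = P j.
  by rewrite /P !starM starK starX starX starK !mulrA.
have PP j : P j * P j = P j.
  rewrite /P !mulrA -[_ * star U ^+ j * U ^+ j]mulrA starUXU mulr1.
  by rewrite -[_ * star S * S]mulrA SS mulr1.
pose b (i : 'I_q) := star S * P i.+1 * S.
have sb : \sum_(i < q) b i = 0.
  have := congr1 (fun x => star S * x * S) sum1.
  rewrite /= big_ord_recl expr0 mul1r /bump /= mulr1 mulr1 SS mulrDr mulrDl !mulrA.
  rewrite SS mul1r SS -[RHS]addr0 => /addrI; rewrite mulr_sumr mulr_suml => E.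
  rewrite -[RHS]E.
  by apply: eq_bigr => i _; rewrite /b /P.
have bs i : star (b i) = b i.
  by rewrite /b (starM (star S * _)) (starM (star S)) starK Ps mulrA.
have nb i : cnorm (1 - b i) <= 1.
  rewrite -SS /b -[X in X * S - _](mulr1 (star S)) -mulrBl -mulrBr.
  apply: cnorm_mul_le1; last exact: cnorm_isometry.
  apply: cnorm_mul_le1; first by rewrite cnorm_star cnorm_isometry.
  apply: cnorm_projection; first by rewrite starB star1 Ps.
  by rewrite mulrBr mulr1 mulrBl mul1r PP subrr subr0.
have := sum_positive_eq0 bs nb sb.
case: l l0 lq => [//|l] _ lq /(_ (Ordinal (lq : (l < q)%N))).
rewrite /b /P /= => bl.
have : star (star S * U ^+ l.+1 * S) = 0; last by move/(congr1 star); rewrite starK star0.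
by apply: cstar_eq0; rewrite starK !starM starK starX -bl !mulrA.
Qed.

Lemma starSX_UX_SX_eq0 m d : ~~ (p ^ m %| d)%N ->
  star S ^+ m * U ^+ d * S ^+ m = 0.
Proof.
have p0 : (0 < p)%N by apply: leq_trans hp.
have [_ _ SS _ _] := (Qp_relationsE p U S).1 hrel.
elim: m d => [|m IH] d ndvd; first by rewrite dvd1n in ndvd.
have [/dvdnP [q dq]|npd] := boolP (p %| d)%N.
  have E : star S * U ^+ d * S = U ^+ q.
    by rewrite dq mulnC -mulrA -S_UX mulrA SS mul1r.
  rewrite exprSr exprS !mulrA -[_ * star S * _]mulrA -[_ * (star S * _) * S]mulrA.
  rewrite E IH //; apply: contra ndvd => ndvd.
  by rewrite dq expnSr dvdn_pmul2r.
have E : star S * U ^+ d * S = 0.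
  rewrite (divn_eq d p) addnC exprD mulnC mulrA -mulrA -S_UX mulrA.
  rewrite starS_UX_S_eq0 ?mul0r // ltn_mod p0 andbT lt0n.
  by move: npd; rewrite /dvdn.
rewrite exprSr exprS !mulrA -[_ * star S * _]mulrA -[_ * (star S * _) * S]mulrA.
by rewrite E mulr0 mul0r.
Qed.

(** In the representation on the square-summable sequences indexed by the integers,
    the isometry onto the sequences supported on [r + p ^ m Z].  It is locked
    so that products and adjoints are not looked for inside it. *)
Definition cyl_iso m r : A := locked (U ^+ r * S ^+ m).

Lemma cyl_isoE m r : cyl_iso m r = U ^+ r * S ^+ m.
Proof. by rewrite /cyl_iso -lock. Qed.

(** The projection onto the sequences supported on [r + p ^ m Z]. *)
Definition cyl m r : A := locked (cyl_iso m r * star (cyl_iso m r)).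

Lemma cylE m r : cyl m r = cyl_iso m r * star (cyl_iso m r).
Proof. by rewrite /cyl -lock. Qed.

Lemma cyl_isoK m r : star (cyl_iso m r) * cyl_iso m r = 1.
Proof.
rewrite cyl_isoE starM !starX !mulrA -[_ * star U ^+ r * _]mulrA starUXU mulr1.
exact: starSXS.
Qed.

Lemma cyl_isoD m r q : cyl_iso m (r + p ^ m * q) = cyl_iso m r * U ^+ q.
Proof. by rewrite !cyl_isoE exprD -!mulrA SX_UX. Qed.

Lemma cyl_iso_orth m r s : (r != s %[mod p ^ m])%N ->
  star (cyl_iso m r) * cyl_iso m s = 0.
Proof.
wlog rs : r s / (r <= s)%N => [H|] nrs.
  have [rs|/ltnW sr] := leqP r s; first exact: H.
  by rewrite -[LHS]starK starM starK H ?star0 // eq_sym.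
rewrite !cyl_isoE starM !starX -(subnKC rs) exprD !mulrA.
rewrite -[_ * star U ^+ r * _]mulrA starUXU mulr1 starSX_UX_SX_eq0 //.
by rewrite -eqn_mod_dvd // eq_sym.
Qed.

Lemma cyl_star m r : star (cyl m r) = cyl m r.
Proof. by rewrite !cylE starM starK. Qed.

Lemma cyl_idem m r : cyl m r * cyl m r = cyl m r.
Proof. by rewrite !cylE mulrA -[_ * _ * cyl_iso m r]mulrA cyl_isoK mulr1. Qed.

Lemma cyl_orth m r s : (r != s %[mod p ^ m])%N -> cyl m r * cyl m s = 0.
Proof.
move=> rs; rewrite !cylE mulrA -[_ * _ * cyl_iso m s]mulrA cyl_iso_orth //.
by rewrite mulr0 mul0r.
Qed.

Lemma cyl_modn m r : cyl m (r %% p ^ m) = cyl m r.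
Proof.
rewrite [in RHS](divn_eq r (p ^ m)) addnC mulnC !cylE cyl_isoD starM starX !mulrA.
by rewrite -[_ * U ^+ _ * _]mulrA UXstarU mulr1.
Qed.

Lemma eq_cyl m r s : (r = s %[mod p ^ m])%N -> cyl m r = cyl m s.
Proof. by move=> rs; rewrite -cyl_modn rs cyl_modn. Qed.

Lemma UX_cyl m r q : U ^+ q * cyl m r = cyl m (q + r) * U ^+ q.
Proof.
have E : cyl_iso m (q + r) = U ^+ q * cyl_iso m r.
  by rewrite !cyl_isoE exprD mulrA.
by rewrite !cylE E starM starX !mulrA -[_ * star U ^+ q * _]mulrA starUXU mulr1.
Qed.

Lemma S_cyl m r : S * cyl m r = cyl m.+1 (p * r) * S.
Proof.
have [_ _ SS _ _] := (Qp_relationsE p U S).1 hrel.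
have E : cyl_iso m.+1 (p * r) = S * cyl_iso m r.
  by rewrite !cyl_isoE mulrA S_UX exprS !mulrA.
by rewrite !cylE E starM !mulrA -[_ * star S * S]mulrA SS mulr1.
Qed.

Lemma cyl_split m r : cyl m r = \sum_(l < p) cyl m.+1 (r + p ^ m * l).
Proof.
have [_ _ _ _ sum1] := (Qp_relationsE p U S).1 hrel.
rewrite cylE -{1}[cyl_iso m r]mulr1 -sum1 mulr_sumr mulr_suml.
apply: eq_bigr => l _.
rewrite [RHS]cylE; have -> : cyl_iso m.+1 (r + p ^ m * l) = cyl_iso m r * U ^+ l * S.
  by rewrite -cyl_isoD !cyl_isoE exprSr mulrA.
by rewrite !starM starX !mulrA.
Qed.

Lemma cyl_refine m r : cyl m r * cyl m.+1 r = cyl m.+1 r.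
Proof.
have p0 : (0 < p)%N by apply: leq_trans hp.
rewrite cyl_split mulr_suml (bigD1 (Ordinal p0)) //= muln0 addn0 cyl_idem.
rewrite big1 ?addr0 // => i i0; rewrite cyl_orth //.
rewrite -[X in (_ == X %[mod _])%N]addn0 eqn_modDl expnSr -muln_modr.
rewrite modn_small // mod0n muln_eq0 negb_or -lt0n expn_gt0 p0 /=.
by apply: contra i0 => i0; apply/eqP/val_inj/eqP.
Qed.

Lemma sum_cyl m : \sum_(r < p ^ m) cyl m r = 1.
Proof.
elim: m => [|m IH].
  by rewrite expn0 big_ord1 !cylE !cyl_isoE !expr0 mulr1 star1 mulr1.
rewrite -[RHS]IH expnS sum_mul exchange_big; apply: eq_bigr => r _ /=.
by rewrite cyl_split; apply: eq_bigr => l _; rewrite addnC mulnC.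
Qed.

End Cylinders.

(** * A representation in which U has a k-th root *)

Section RootRepresentation.
Context {R : realType} {A : cstarType R} (p : nat) (U S : A).
Hypothesis hp : (2 <= p)%N.
Hypothesis hrel : Qp_relations p U S.
Context (k n : nat).
Hypothesis k0 : (0 < k)%N.
Hypothesis kp : coprime k p.
Hypothesis kn : (k <= p ^ n)%N.

Local Notation W := (cyl_iso U S n).

(** The isometries [W r] for [r < p ^ n] have orthogonal ranges summing to [1], so
    they form a basis of the algebra as a right module over itself, and
    [frame_map F] is the module map sending [W r] to [F r]. *)
Definition frame_map (F : nat -> A) : A := \sum_(r < p ^ n) F r * star (W r).

Lemma frame_map_cyl_iso F r : (r < p ^ n)%N -> frame_map F * W r = F r.
Proof.
move=> rn; rewrite /frame_map mulr_suml (bigD1 (Ordinal rn)) //= -mulrA.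
rewrite (cyl_isoK hrel) mulr1 big1 ?addr0 // => s sr.
rewrite -mulrA (cyl_iso_orth hp hrel) ?mulr0 // !modn_small //.
Qed.

Lemma frame_ext X Y : (forall r, (r < p ^ n)%N -> X * W r = Y * W r) -> X = Y.
Proof.
move=> XY; rewrite -[X]mulr1 -[Y]mulr1 -(sum_cyl hrel n) !mulr_sumr.
by apply: eq_bigr => r _; rewrite !cylE !mulrA XY.
Qed.

Lemma frame_map_coisometry F :
  frame_map F * star (frame_map F) = \sum_(r < p ^ n) F r * star (F r).
Proof.
rewrite {1}/frame_map mulr_suml; apply: eq_bigr => r _; rewrite -mulrA -starM.
by rewrite frame_map_cyl_iso.
Qed.

Lemma frame_map_isometry F : (forall r s, (r < p ^ n)%N -> (s < p ^ n)%N ->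
  star (F r) * F s = (r == s)%:R) -> star (frame_map F) * frame_map F = 1.
Proof.
move=> FF; rewrite [X in _ * X]/frame_map mulr_sumr.
rewrite -[RHS](sum_cyl hrel n); apply: eq_bigr => s _.
rewrite !cylE mulrA; congr (_ * _); rewrite /frame_map star_sum mulr_suml.
rewrite (bigD1 s) //= starM starK -mulrA FF // eqxx mulr1.
rewrite big1 ?addr0 // => r rs; rewrite starM starK -mulrA FF //.
by rewrite (negbTE (rs : r != s :> nat)) mulr0.
Qed.

(** A sequence built from the first [k] isometries [W r] by
    the rule [T (t + k) = T t * U]: along it the shift [T t |-> T t.+1] is a
    [k]-th root of [U]. *)
Definition tower t : A := locked (W (t %% k) * U ^+ (t %/ k)).
Local Notation T := tower.

Lemma tower_def t : T t = W (t %% k) * U ^+ (t %/ k).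
Proof. by rewrite /T -lock. Qed.

Lemma tower_small r : (r < k)%N -> T r = W r.
Proof. by move=> rk; rewrite !tower_def modn_small // divn_small // mulr1. Qed.

Lemma towerD t q : T (t + k * q) = T t * U ^+ q.
Proof.
by rewrite !tower_def mulnC addnC modnMDl divnMDl // [(q + _)%N]addnC exprD mulrA.
Qed.

Lemma towerK t : star (T t) * T t = 1.
Proof.
rewrite !tower_def starM starX !mulrA -[_ * star (W _) * _]mulrA (cyl_isoK hrel) mulr1.
exact: (starUXU hrel).
Qed.

Lemma cyl_iso_orth_lt r s : (r < p ^ n)%N -> (s < p ^ n)%N -> r != s ->
  star (W r) * W s = 0.
Proof. by move=> rn sn rs; rewrite (cyl_iso_orth hp hrel) // !modn_small. Qed.

Lemma mod_lt t : (t %% k < p ^ n)%N.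
Proof. by apply: leq_trans kn; rewrite ltn_mod. Qed.

Lemma tower_orth t s : (t != s %[mod k])%N -> star (T t) * T s = 0.
Proof.
move=> ts; rewrite !tower_def starM starX !mulrA -[_ * star (W _) * _]mulrA.
by rewrite cyl_iso_orth_lt ?mod_lt // mulr0 mul0r.
Qed.

Lemma tower_cyl_iso_orth t r : (k <= r < p ^ n)%N -> star (T t) * W r = 0.
Proof.
move=> /andP[kr rn]; rewrite !tower_def starM starX -mulrA.
rewrite cyl_iso_orth_lt ?mod_lt ?mulr0 // neq_ltn.
by rewrite (leq_trans _ kr) // ltn_mod.
Qed.

Lemma cyl_iso_tower_orth t r : (k <= r < p ^ n)%N -> star (W r) * T t = 0.
Proof.
by move=> rk; rewrite -[LHS]starK starM starK tower_cyl_iso_orth ?star0.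
Qed.

Lemma tower_range t : T t * star (T t) = W (t %% k) * star (W (t %% k)).
Proof.
by rewrite !tower_def starM starX !mulrA -[_ * U ^+ _ * _]mulrA (UXstarU hrel) mulr1.
Qed.

Lemma sum_split (V : nmodType) (F : nat -> V) : \sum_(r < p ^ n) F r =
  \sum_(r < k) F r + \sum_(r < p ^ n - k) F (k + r)%N.
Proof.
rewrite -(big_mkord xpredT F) (big_cat_nat (leq0n k) kn) /= big_mkord.
congr (_ + _); rewrite -{1}[k]add0n big_addn big_mkord.
by apply: eq_bigr => r _; rewrite addnC.
Qed.

Definition unitary_image r := if (r < k)%N then T r.+1 else W r * U.
Definition isometry_image r := if (r < k)%N then T (p * r) * S else W r * S.

(** On the towers, shift the index by 1 and dilate it by [p]; on the remaining
    [W r], act by [U] and [S] themselves.  This is what makes the operators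
    satisfy the defining relations without leaving the algebra. *)
Definition root_unitary := frame_map unitary_image.
Definition root_isometry := frame_map isometry_image.
Local Notation u := root_unitary.
Local Notation s := root_isometry.

Lemma root_unitary_tower t : u * T t = T t.+1.
Proof.
rewrite [T t]tower_def mulrA frame_map_cyl_iso ?mod_lt // /unitary_image ltn_mod k0.
by rewrite -towerD addSn mulnC addnC -divn_eq.
Qed.

Lemma root_unitaryX_tower l t : u ^+ l * T t = T (l + t).
Proof.
elim: l => [|l IH]; first by rewrite mul1r.
by rewrite exprS -mulrA IH root_unitary_tower.
Qed.

Lemma root_unitaryX_cyl_iso l r : (k <= r < p ^ n)%N ->
  u ^+ l * W r = W r * U ^+ l.
Proof.
move=> /andP[kr rn]; elim: l => [|l IH]; first by rewrite mul1r mulr1.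
rewrite exprS -mulrA IH mulrA frame_map_cyl_iso // /unitary_image ltnNge kr /=.
by rewrite -mulrA -exprS.
Qed.

Lemma root_isometry_cyl_iso r : (k <= r < p ^ n)%N -> s * W r = W r * S.
Proof.
by move=> /andP[kr rn]; rewrite frame_map_cyl_iso // /isometry_image ltnNge kr.
Qed.

Lemma root_isometry_tower t : s * T t = T (p * t) * S.
Proof.
rewrite [T t]tower_def mulrA frame_map_cyl_iso ?mod_lt // /isometry_image ltn_mod k0.
rewrite -mulrA (S_UX hrel) mulrA -towerD; congr (T _ * _).
by rewrite mulnCA -mulnDr [(k * _)%N]mulnC addnC -divn_eq.
Qed.

(** On the towers the pair repeats the action of the shift and of the dilation on
    the integers.  Coprimality of [k] and [p] makes the indices [p * r] distinct
    modulo [k], hence [root_isometry] isometric; the ranges fill up because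
    [p * r + l] takes every value below [k * p] once. *)
Lemma root_relations : Qp_relations p u s.
Proof.
have [UU1 UU2 SS SU sum1] := (Qp_relationsE p U S).1 hrel.
have rP r : (r < p ^ n)%N -> (r < k)%N \/ (k <= r < p ^ n)%N.
  by move=> rn; have [rk|rk] := ltnP r k; [left|right].
have ltW r (rk : (k <= r)%N) : (r < k)%N = false by rewrite ltnNge rk.
apply/Qp_relationsE; split.
- apply: frame_map_isometry => r t rn tn; rewrite /unitary_image.
  have [->|rt] := eqVneq r t.
    case: ifP => _; first exact: towerK.
    by rewrite starM !mulrA -[_ * star (W _) * _]mulrA (cyl_isoK hrel) mulr1.
  have [rk|rk] := ltnP r k; have [tk|tk] := ltnP t k.
  + rewrite tower_orth // -addn1 -[t.+1]addn1 eqn_modDr !modn_small //.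
  + by rewrite mulrA tower_cyl_iso_orth ?mul0r // tk.
  + by rewrite starM -mulrA cyl_iso_tower_orth ?mulr0 // rk.
  + by rewrite starM !mulrA -[_ * star (W _) * _]mulrA cyl_iso_orth_lt // mulr0 mul0r.
- rewrite frame_map_coisometry -[RHS](sum_cyl hrel n) (sum_split (cyl U S n)).
  rewrite (sum_split (fun r => unitary_image r * star (unitary_image r))).
  congr (_ + _).
    rewrite /unitary_image.
    pose G t := W (t %% k) * star (W (t %% k)).
    transitivity (\sum_(r < k) G (1 * r + 1)%N).
      by apply: eq_bigr => r _; rewrite ltn_ord tower_range mul1n addn1.
    rewrite sum_periodic ?coprimen1 //; last by move=> t; rewrite /G modnDr.
    by apply: eq_bigr => r _; rewrite /G modn_small // cylE.
  apply: eq_bigr => r _; rewrite /unitary_image ltW ?leq_addr //.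
  by rewrite starM mulrA -[_ * U * _]mulrA UU2 mulr1 cylE.
- apply: frame_map_isometry => r t rn tn; rewrite /isometry_image.
  have [->|rt] := eqVneq r t.
    case: ifP => _; rewrite starM !mulrA -[_ * star _ * _]mulrA.
      by rewrite towerK mulr1.
    by rewrite (cyl_isoK hrel) mulr1.
  have [rk|rk] := ltnP r k; have [tk|tk] := ltnP t k; rewrite starM !mulrA.
  + rewrite -[_ * star (T _) * _]mulrA tower_orth ?mulr0 ?mul0r //.
    by rewrite eqn_modMl_coprime // !modn_small.
  + by rewrite -[_ * star (T _) * _]mulrA tower_cyl_iso_orth ?mulr0 ?mul0r // tk.
  + by rewrite -[_ * star (W _) * _]mulrA cyl_iso_tower_orth ?mulr0 ?mul0r // rk.
  + by rewrite -[_ * star (W _) * _]mulrA cyl_iso_orth_lt // mulr0 mul0r.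
- apply: frame_ext => r rn; rewrite -!mulrA; have [rk|rk] := rP _ rn.
    rewrite -tower_small // root_unitary_tower !root_isometry_tower mulrA.
    by rewrite root_unitaryX_tower mulnS.
  rewrite -[X in s * (X * _)]expr1 root_unitaryX_cyl_iso // mulrA.
  rewrite root_isometry_cyl_iso // mulrA root_unitaryX_cyl_iso //.
  by rewrite -mulrA expr1 SU mulrA.
transitivity (\sum_(l < p) \sum_(r < p ^ n)
    (u ^+ l * isometry_image r) * star (u ^+ l * isometry_image r)).
  apply: eq_bigr => l _; rewrite -(mulrA (u ^+ l)) frame_map_coisometry mulr_sumr mulr_suml.
  by apply: eq_bigr => r _; rewrite starM starX !mulrA.
rewrite exchange_big /= -[RHS](sum_cyl hrel n).
rewrite (sum_split (fun r =>
  \sum_(l < p) (u ^+ l * isometry_image r) * star (u ^+ l * isometry_image r))).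
rewrite (sum_split (cyl U S n)); congr (_ + _).
  pose H t := (T t * S) * star (T t * S).
  transitivity (\sum_(r < k) \sum_(l < p) H (r * p + l)%N).
    apply: eq_bigr => r _; apply: eq_bigr => l _.
    by rewrite /isometry_image ltn_ord mulrA root_unitaryX_tower addnC mulnC.
  rewrite -sum_mul mulnC sum_mul exchange_big; apply: eq_bigr => r _ /=.
  transitivity (\sum_(l < p) W r * (U ^+ l * S * star S * star U ^+ l) * star (W r)).
    apply: eq_bigr => l _; rewrite /H addnC mulnC towerD tower_small //.
    by rewrite !starM starX !mulrA.
  by rewrite -mulr_suml -mulr_sumr sum1 mulr1 cylE.
apply: eq_bigr => r _; set r' := (k + r)%N.
have r'k : (k <= r' < p ^ n)%N by rewrite leq_addr /= -ltn_subRL.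
transitivity (\sum_(l < p) W r' * (U ^+ l * S * star S * star U ^+ l) * star (W r')).
  apply: eq_bigr => l _; rewrite /isometry_image ltW ?leq_addr // mulrA.
  by rewrite root_unitaryX_cyl_iso // !starM starX !mulrA.
by rewrite -mulr_suml -mulr_sumr sum1 mulr1 cylE.
Qed.

End RootRepresentation.

(** * The conditional expectation onto the range of chi *)

Section Expectation.
Context {R : realType} (p : nat) (Q : cstarType R) (U S : Q).
Hypothesis hp : (2 <= p)%N.
Hypothesis hQ : is_Qp p U S.

Let hrel : Qp_relations p U S. Proof. by case: hQ. Qed.

Lemma Qp_hom_unique (f g : Q -> Q) : star_hom f -> star_hom g ->
  f U = g U -> f S = g S -> f = g.
Proof.
move=> hf hg fgU fgS; have [_ _ univ] := hQ.
have [h [_ uniq_h]] := univ Q (f U) (f S) (Qp_relations_hom hf hrel).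
by rewrite -(uniq_h f) // -(uniq_h g).
Qed.

Lemma star_hom_id : star_hom (@id Q).
Proof. by []. Qed.

(** Uniqueness in the universal property propagates the relation from the
    generators.  The element [e = V * star V] is [c] times a projection, so [w = 1 - (2 / c) e] is a self-adjoint unitary; it commutes
    with [f U] and [f S], so conjugating [f] by [w] gives [f] again, and [e]
    commutes with the range of [f].  Then [x |-> c^-1 star V * f x * V] is a
    star-homomorphism fixing [U] and [S], hence the identity. *)
Lemma star_hom_intertwine (f : Q -> Q) (V : Q) c : (0 < c)%N -> star_hom f ->
  star V * V = c%:R -> f U * V = V * U -> f S * V = V * S ->
  forall x, f x * V = V * x.
Proof.
move=> c0 hf VV fU fS.
have cR : (c%:R : R[i]) != 0 by rewrite pnatr_eq0 -lt0n.
have cJ : Num.conj (c%:R^-1 : R[i]) = c%:R^-1 by rewrite fmorphV /= conjC_nat.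
have VVc : star V * V = (c%:R : R[i]) *: 1 by rewrite VV scaler_nat.
have [UU1 UU2 SS SU sum1] := (Qp_relationsE p U S).1 hrel.
have [fUU1 fUU2 fSS fSU _] := (Qp_relationsE p _ _).1 (Qp_relations_hom hf hrel).
have fUs : star (f U) * V = V * star U.
  have <- : star (f U) * (f U * V) * star U = star (f U) * V.
    by rewrite fU -!mulrA UU2 mulr1.
  by rewrite !mulrA fUU1 mul1r.
have fUX l : f U ^+ l * V = V * U ^+ l.
  elim: l => [|l IH]; first by rewrite mul1r mulr1.
  by rewrite exprS -mulrA IH mulrA fU -mulrA -exprS.
have fSs : star (f S) * V = V * star S.
  (* Expand [V] along the ranges of the [f (U ^+ l * S)]; only [l = 0] survives. *)
  have VE : V = \sum_(l < p) f (U ^+ l * S) * (V * (star S * star U ^+ l)).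
    rewrite -[LHS]mulr1 -sum1 mulr_sumr; apply: eq_bigr => l _.
    by rewrite (star_homM hf) (star_homX hf) !mulrA -[_ * f S * V]mulrA fS !mulrA fUX.
  have p0 : (0 < p)%N by apply: leq_trans hp.
  rewrite {1}VE mulr_sumr (bigD1 (Ordinal p0)) //= big1 ?addr0.
    by rewrite !expr0 mulr1 mul1r mulrA fSS mul1r.
  move=> l l0; rewrite mulrA (star_homM hf) (star_homX hf) mulrA.
  rewrite !mulrA (starS_UX_S_eq0 hp (Qp_relations_hom hf hrel)) ?mul0r //.
  rewrite ltn_ord andbT lt0n; apply: contra l0 => /eqP l0.
  exact/eqP/val_inj.
pose e := V * star V.
have es : star e = e by rewrite /e starM starK.
have ee : e * e = (c%:R : R[i]) *: e.
  by rewrite /e mulrA -[_ * star V * V]mulrA VVc -scalerAr mulr1 -scalerAl.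
have comm_e y y0 : y * V = V * y0 -> star y * V = V * star y0 -> y * e = e * y.
  move=> yV /(congr1 star); rewrite !starM !starK => Vy.
  by rewrite /e mulrA yV -mulrA -Vy mulrA.
pose a : R[i] := 2 / c%:R.
have a0 : a != 0 by rewrite mulf_neq0 ?invr_eq0 // pnatr_eq0.
pose w : Q := 1 - a *: e.
have ws : star w = w.
  by rewrite /w starB star1 starZ es rmorphM /= cJ conjC_nat.
have ww : w * w = 1.
  rewrite /w mulrBr mulr1 mulrBl mul1r -scalerAl -scalerAr ee !scalerA.
  have -> : a * a * c%:R = a + a by rewrite /a; field.
  by rewrite scalerDl opprB addrK subrK.
have wE : w = 1 - a *: e by [].
clearbody w.
have comm_w y : y * e = e * y -> y * w = w * y.
  by move=> ye; rewrite wE mulrBr mulrBl mulr1 mul1r -scalerAr -scalerAl ye.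
have fix_w y : y * e = e * y -> w * y * w = y.
  by move=> /comm_w yw; rewrite -yw -mulrA ww mulr1.
have fE x : f x * e = e * f x.
  have /(congr1 (@^~ x)) /= : (fun x => w * f x * w) = f.
    apply: Qp_hom_unique => //.
    - split=> [b x1 x2||x1 x2|x1].
      + by rewrite (star_hom_lin hf) mulrDr mulrDl -scalerAr -scalerAl.
      + by rewrite (star_hom1 hf) mulr1 ww.
      + by rewrite (star_homM hf) !mulrA -[_ * w * w]mulrA ww mulr1.
      + by rewrite (star_hom_star hf) !starM ws mulrA.
    - exact: fix_w (comm_e _ _ fU fUs).
    - exact: fix_w (comm_e _ _ fS fSs).
  move=> wfw; have : w * f x = f x * w.
    by rewrite -[in RHS]wfw -[RHS]mulrA ww mulr1.
  rewrite wE mulrBr mulrBl mulr1 mul1r => /addrI/oppr_inj.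
  by rewrite -scalerAl -scalerAr => /(scalerI a0).
have fV x : star V * f x * V = (c%:R : R[i]) *: x.
  suff /(congr1 (@^~ x)) /= h :
      (fun x => c%:R^-1 *: (star V * f x * V)) = (@id Q).
    by rewrite -[x in RHS]h scalerA mulfV // scale1r.
  apply: Qp_hom_unique; last 1 first.
  - by rewrite -mulrA fS mulrA VVc -scalerAl mul1r scalerA mulVf // scale1r.
  - split=> [b x1 x2||x1 x2|x1].
    + rewrite (star_hom_lin hf) mulrDr mulrDl -scalerAr -scalerAl scalerDr.
      by rewrite !scalerA mulrC.
    + by rewrite (star_hom1 hf) mulr1 VVc scalerA mulVf // scale1r.
    + rewrite -scalerAl -scalerAr (star_homM hf).
      have -> : star V * f x1 * V * (star V * f x2 * V) =
                star V * (f x1 * e) * f x2 * V by rewrite /e !mulrA.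
      rewrite fE /e !mulrA VVc -!scalerAl mul1r; congr (_ *: _).
      by rewrite scalerA mulVf // scale1r.
    + by rewrite starZ !starM starK cJ (star_hom_star hf) mulrA.
  - exact: star_hom_id.
  - by rewrite -mulrA fU mulrA VVc -scalerAl mul1r scalerA mulVf // scale1r.
move=> x; apply: (scalerI cR).
transitivity (f x * e * V).
  by rewrite /e !mulrA -[_ * star V * V]mulrA VVc -scalerAr mulr1.
by rewrite fE /e -!mulrA (mulrA (star V)) fV -scalerAr.
Qed.

Context (k n : nat).
Hypothesis k0 : (0 < k)%N.
Hypothesis kp : coprime k p.
Hypothesis kn : (k <= p ^ n)%N.
Context (chi rho : Q -> Q).
Hypothesis hchi : star_hom chi.
Hypothesis chiU : chi U = U ^+ k.
Hypothesis chiS : chi S = S.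
Hypothesis hrho : star_hom rho.
Hypothesis rhoU : rho U = root_unitary p U S k n.
Hypothesis rhoS : rho S = root_isometry p U S k n.

Local Notation T := (tower U S k n).

Lemma rho_UX_tower l t : rho (U ^+ l) * T t = T (l + t).
Proof. by rewrite (star_homX hrho) rhoU (root_unitaryX_tower hp hrel). Qed.

Lemma rho_S_tower t : rho S * T t = T (p * t) * S.
Proof. by rewrite rhoS (root_isometry_tower hp hrel). Qed.

(** The [k]-th power of the shift of the tower is [U], so the zeroth isometry of the
    tower intertwines [rho \o chi] with the identity. *)
Lemma rho_chi x : rho (chi x) * T 0 = T 0 * x.
Proof.
apply: (@star_hom_intertwine (rho \o chi) (T 0) 1) => //=.
- exact: star_hom_comp.
- by rewrite (towerK hrel).
- rewrite chiU rho_UX_tower -[U in RHS]expr1 -(towerD _ _ _ k0).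
  by rewrite addn0 muln1 add0n.
- by rewrite chiS rho_S_tower muln0.
Qed.

Definition untwist x := star (T 0) * rho x * T 0.

Lemma chiK x : untwist (chi x) = x.
Proof. by rewrite /untwist -mulrA rho_chi mulrA (towerK hrel) mul1r. Qed.

(** The terms depend on [j] only modulo [k], which is why shifting and dilating
    the index leaves the sum unchanged. *)
Definition tower_row := \sum_(j < k) chi (T j) * star U ^+ j.

Lemma chi_rho x : chi (rho x) * tower_row = tower_row * x.
Proof.
pose F t := chi (T t) * star U ^+ t.
have Fk t : F (t + k)%N = F t.
  rewrite /F -[X in T (t + X)]muln1 (towerD _ _ _ k0) (star_homM hchi) expr1 chiU.
  rewrite addnC exprD !mulrA -[_ * U ^+ k * _]mulrA (UXstarU hrel).
  by rewrite mulr1.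
have [UU1 UU2 SS SU sum1] := (Qp_relationsE p U S).1 hrel.
apply: (@star_hom_intertwine (chi \o rho) tower_row k) => //=.
- exact: star_hom_comp.
- have -> : (k%:R : Q) = \sum_(i < k) 1 by rewrite sumr_const card_ord.
  rewrite {1}/tower_row star_sum mulr_suml.
  apply: eq_big => [//|i _]; rewrite /tower_row mulr_sumr (bigD1 i) //=.
  rewrite starM starX starK mulrA -[_ * _ * chi (T i)]mulrA.
  rewrite -(star_hom_star hchi) -(star_homM hchi) (towerK hrel) (star_hom1 hchi).
  rewrite mulr1 (UXstarU hrel) big1 ?addr0 // => j ji.
  rewrite mulrA -[_ * _ * chi (T j)]mulrA.
  rewrite -(star_homM hchi) (tower_orth hp hrel) ?(star_hom0 hchi) ?mulr0 ?mul0r //.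
  by rewrite !modn_small // eq_sym.
- have -> : tower_row = \sum_(j < k) F (1 * j + 1)%N.
    by rewrite sum_periodic ?coprimen1.
  rewrite mulr_suml.
  have -> : \sum_(j < k) F (1 * j + 1)%N * U = \sum_(j < k) chi (T j.+1) * star U ^+ j.
    apply: eq_bigr => j _; rewrite /F mul1n addn1 exprSr !mulrA -mulrA UU1 mulr1.
    by [].
  rewrite sum_periodic ?coprimen1 // mulr_sumr; apply: eq_bigr => j _.
  by rewrite /F mulrA -(star_homM hchi) -{1}[U]expr1 rho_UX_tower.
- have -> : tower_row * S = \sum_(j < k) F (p * j + 0)%N * S.
    by rewrite -mulr_suml sum_periodic.
  rewrite /tower_row mulr_sumr; apply: eq_bigr => j _.
  rewrite mulrA -(star_homM hchi) rho_S_tower (star_homM hchi) chiS addn0 /F.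
  rewrite -!mulrA; congr (_ * _).
  have : star U ^+ (p * j) * (S * U ^+ j) * star U ^+ j = star U ^+ (p * j) * S.
    by rewrite mulrA -mulrA (UXstarU hrel) mulr1.
  by rewrite (S_UX hrel) mulrA (starUXU hrel) mul1r.
Qed.

Definition twisted_exp x := chi (untwist x).
Local Notation E := twisted_exp.

Lemma twisted_exp_star x : E (star x) = star (E x).
Proof.
rewrite /E /untwist -(star_hom_star hchi) !starM starK (star_hom_star hrho).
by rewrite mulrA.
Qed.

(** Compare [star tower_row * chi (rho x) = x * star tower_row] on the zeroth
    isometry of the tower. *)
Lemma twisted_expansion x : x = \sum_(j < k) U ^+ j * E (star (U ^+ j) * x).
Proof.
have row_rho : star tower_row * chi (rho x) = x * star tower_row.
  have /(congr1 star) := chi_rho (star x).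
  by rewrite !starM -(star_hom_star hchi) -(star_hom_star hrho) !starK.
have row0 : star tower_row * chi (T 0) = 1.
  rewrite star_sum mulr_suml (bigD1 (Ordinal k0)) //= big1 ?addr0 => [|j j0].
    rewrite expr0 mulr1 -(star_hom_star hchi) -(star_homM hchi) (towerK hrel).
    exact: star_hom1.
  rewrite starM -mulrA -(star_hom_star hchi) -(star_homM hchi).
  rewrite (tower_orth hp hrel) ?(star_hom0 hchi) ?mulr0 //.
  by rewrite mod0n modn_small.
rewrite -[LHS]mulr1 -row0 mulrA -row_rho star_sum !mulr_suml.
apply: eq_bigr => j _.
rewrite starM starX starK -!mulrA -(star_hom_star hchi) -!(star_homM hchi).
congr (_ * chi _); rewrite /untwist (star_homM hrho) (star_hom_star hrho).
by rewrite !mulrA -starM rho_UX_tower addn0.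
Qed.

(** Positivity and the module property hold because [untwist] is a compression of
    a star-homomorphism, faithfulness because [twisted_expansion] recovers [x]
    from [rho x * T 0]. *)
Lemma twisted_exp_cond : faithful_cond_exp (range chi) E.
Proof.
have chi_inj : injective chi := can_inj chiK.
have LM a x b : untwist (chi a * x * chi b) = a * untwist x * b.
  rewrite /untwist !(star_homM hrho) -!mulrA rho_chi !mulrA; congr (_ * _ * _ * _).
  apply: (can_inj (@starK _ Q)); rewrite !starM starK -(star_hom_star hrho).
  by rewrite -(star_hom_star hchi) rho_chi.
split.
- move=> c x y; rewrite /E /untwist (star_hom_lin hrho) mulrDr mulrDl.
  by rewrite -scalerAr -scalerAl (star_hom_lin hchi).
- split=> [x|_ [x _ <-]]; first by exists (untwist x).
  by rewrite /E chiK.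
- move=> _ x _ [a _ <-] [b _ <-]; rewrite /E LM !(star_homM hchi).
  by [].
- move=> _ [y ->]; exists (chi (rho y * T 0)).
  rewrite -(star_hom_star hchi) -(star_homM hchi) /E /untwist (star_homM hrho).
  by rewrite (star_hom_star hrho) starM !mulrA.
- move=> x Ex0.
  have : untwist (star x * x) = 0 by apply: chi_inj; rewrite (star_hom0 hchi).
  rewrite /untwist (star_homM hrho) (star_hom_star hrho) => x0.
  have {}x0 : rho x * T 0 = 0 by apply: cstar_eq0; rewrite starM -x0 !mulrA.
  rewrite [LHS]twisted_expansion big1 // => j _.
  rewrite /E /untwist (star_homM hrho) -!mulrA x0 !mulr0 (star_hom0 hchi).
  by rewrite mulr0.
Qed.

Lemma twisted_quasi_basis : quasi_basis E (fun j : 'I_k => U ^+ j).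
Proof.
move=> x; split; first exact: twisted_expansion.
rewrite -[LHS]starK {1}(twisted_expansion (star x)) star_sum.
apply: eq_bigr => j _; rewrite starM; congr (_ * _).
by rewrite -twisted_exp_star starM !starK.
Qed.

Lemma twisted_index : has_index E (real_complex R k%:R *: 1).
Proof.
exists k, (fun j : 'I_k => U ^+ j); split; first exact: twisted_quasi_basis.
rewrite rmorph_nat scaler_nat -[k in LHS]card_ord -sumr_const.
by apply: eq_bigr => j _; rewrite starX (UXstarU hrel).
Qed.

End Expectation.

(** * Block diagonal elements *)

Lemma bernoulli_le (R : realType) (d : R) n : 0 <= d -> 1 + d *+ n <= (1 + d) ^+ n.
Proof.
move=> d0; elim: n => [|n IH]; first by rewrite expr0 mulr0n addr0.
rewrite exprS; apply: le_trans (ler_wpM2l (addr_ge0 ler01 d0) IH).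
by rewrite -![d *+ _]mulr_natl -natr1; have := ler0n R n; nra.
Qed.

Lemma le_of_le_exp (R : realType) (a e M : R) : 0 <= e ->
  (forall n, a ^+ (2 ^ n) <= M * e ^+ (2 ^ n)) -> a <= e.
Proof.
move=> e0 H; rewrite leNgt; apply/negP => ea.
have [e00|ne0] := eqVneq e 0.
  by have := H 0; rewrite expn0 !expr1 e00 mulr0; rewrite -e00 leNgt ea.
have {ne0}e1 : 0 < e by rewrite lt_neqAle eq_sym ne0.
pose d := a / e - 1.
have d0 : 0 < d by rewrite subr_gt0 ltr_pdivlMr // mul1r.
have M0 : 0 <= M.
  by have := H 0; rewrite expn0 !expr1 => aM; rewrite -(pmulr_lge0 _ e1); lra.
pose n := Num.bound (M / d).
have := archi_boundP (divr_ge0 M0 (ltW d0)); rewrite -/n ltr_pdivrMr // => Mn.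
have := H n; rewrite -ler_pdivrMr ?exprn_gt0 // -expr_div_n.
have -> : a / e = 1 + d by rewrite /d addrC subrK.
move=> h; have := le_trans (bernoulli_le (2 ^ n) (ltW d0)) h.
have : d *+ n <= d *+ (2 ^ n) by apply: ler_wpMn2l (ltnW (ltn_expl _ _)); rewrite ?ltW.
by rewrite -[d *+ n]mulr_natl; lra.
Qed.

Section BlockNorm.
Context {R : realType} {A : cstarType R}.

Lemma cnorm_selfadjoint_exp (h : A) n :
  star h = h -> cnorm (h ^+ (2 ^ n)) = cnorm h ^+ (2 ^ n).
Proof.
move=> hs; elim: n => [|n IH]; first by rewrite expn0 !expr1.
have sn : star (h ^+ (2 ^ n)) = h ^+ (2 ^ n) by rewrite starX hs.
by rewrite expnSr !exprM -IH -cnorm_star_mul sn expr2.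
Qed.

(** A block diagonal self-adjoint element is no larger than its blocks: the powers
    [h ^+ (2 ^ n)] have norm [cnorm h ^+ (2 ^ n)] but are bounded by [m] times
    the powers of [e], and [m] disappears in the limit. *)
Lemma cnorm_block_diag m (q : 'I_m -> A) (h : A) (e : R) :
  (forall i, q i * q i = q i) -> \sum_(i < m) q i = 1 -> star h = h ->
  (forall i, h * q i = q i * h) -> (forall i, cnorm (q i * h) <= e) ->
  0 <= e -> cnorm h <= e.
Proof.
move=> qq q1 hs hq he e0.
apply: (@le_of_le_exp _ _ _ m%:R) => // n.
rewrite -cnorm_selfadjoint_exp //.
have qX i l : q i * h ^+ l.+1 = (q i * h) ^+ l.+1.
  elim: l => [|l IH]; first by rewrite !expr1.
  by rewrite exprS [RHS]exprS -IH -mulrA (mulrA h) hq !mulrA qq.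
rewrite -[h ^+ _]mul1r -q1 mulr_suml.
apply: le_trans (ler_cnorm_sum _ _ _) _.
rewrite mulr_natl -[m in leRHS]card_ord -sumr_const; apply: ler_sum => i _.
rewrite -(prednK (_ : 0 < 2 ^ n)%N) ?expn_gt0 // qX.
elim: (2 ^ n).-1 => [|l IH]; first by rewrite !expr1.
rewrite exprS [leRHS]exprS; apply: le_trans (ler_cnormM _ _) _.
by apply: ler_pM; rewrite ?cnorm_ge0.
Qed.

End BlockNorm.

(** * Elements that move cylinders by a fractional translation *)

Lemma dvdz_subn d a b : (d%:Z %| a%:Z - b%:Z)%Z = (a == b %[mod d])%N.
Proof. by rewrite -eqz_mod_dvd !modz_nat eqz_nat. Qed.

Section GraphSpan.
Context {R : realType} (p : nat) (Q : cstarType R) (U S : Q).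
Hypothesis hp : (2 <= p)%N.
Hypothesis hQ : is_Qp p U S.

Let hrel : Qp_relations p U S. Proof. by case: hQ. Qed.
Local Notation P := (cyl U S).

(** [M] only moves mass from [l'] to [l] when [(l', l)] is [p]-adically close to
    the line [p ^ n * l = p ^ m * l' + c].  Every monomial in [U], [S] and their adjoints
    has this property, and unlike the normal form of monomials it is visibly
    stable under products. *)
Definition graph_supported (M : Q) := exists m n (c : int), forall N l l' : nat,
  ~~ ((p ^ N)%:Z %| (p ^ n)%:Z * l%:Z - (p ^ m)%:Z * l'%:Z - c)%Z ->
  P N l * M * P N l' = 0.

Inductive graph_span : Q -> Prop :=
| graph_span_gen M : graph_supported M -> graph_span M
| graph_span_lin (c : R[i]) x y :
    graph_span x -> graph_span y -> graph_span (c *: x + y).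

Lemma graph_supported1 : graph_supported 1.
Proof.
exists 0, 0, 0 => N l l'; rewrite !expn0 !mul1r subr0 dvdz_subn mulr1.
exact: (cyl_orth hp hrel).
Qed.

Lemma graph_supportedU : graph_supported U.
Proof.
exists 0, 0, 1 => N l l'; rewrite !expn0 !mul1r -addrA -opprD -PoszD dvdz_subn.
move=> ll'; rewrite -mulrA -[X in P N l * (X * _)]expr1 (UX_cyl hrel) mulrA add1n.
by rewrite (cyl_orth hp hrel) ?mul0r // -addn1.
Qed.

Lemma graph_supportedS : graph_supported S.
Proof.
exists 1, 0, 0 => N l l'; rewrite subr0 expn0 mul1r expn1 -PoszM dvdz_subn.
move=> ll'; rewrite -mulrA (S_cyl hrel) -(cyl_refine hp hrel) !mulrA.
by rewrite (cyl_orth hp hrel) // !mul0r.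
Qed.

Lemma graph_supported_star M : graph_supported M -> graph_supported (star M).
Proof.
move=> [m [n [c MP]]]; exists n, m, (- c) => N l l' nd.
apply: (can_inj (@starK _ Q)).
rewrite star0 !starM starK !cyl_star mulrA MP //.
apply: contra nd => nd.
have -> : (p ^ m)%:Z * l%:Z - (p ^ n)%:Z * l'%:Z - - c =
  - ((p ^ n)%:Z * l'%:Z - (p ^ m)%:Z * l%:Z - c) by ring.
by rewrite rpredN.
Qed.

Lemma graph_supportedM M M' :
  graph_supported M -> graph_supported M' -> graph_supported (M * M').
Proof.
move=> [m [n [c MP]]] [m' [n' [c' MP']]].
exists (m + m')%N, (n + n')%N, ((p ^ n')%:Z * c + (p ^ m)%:Z * c') => N l l' nd.
rewrite -[M]mulr1 -(sum_cyl hrel N) mulr_sumr mulr_suml mulr_sumr mulr_suml.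
apply: big1 => t _.
have -> : P N l * (M * P N t * M') * P N l' =
          (P N l * M * P N t) * (P N t * M' * P N l').
  by rewrite !mulrA -[_ * P N t * P N t]mulrA (cyl_idem hrel).
have [d1|/MP ->] := boolP
  ((p ^ N)%:Z %| (p ^ n)%:Z * l%:Z - (p ^ m)%:Z * t%:Z - c)%Z; last by rewrite mul0r.
rewrite MP' ?mulr0 //; apply: contra nd => d2.
have -> : (p ^ (n + n'))%:Z * l%:Z - (p ^ (m + m'))%:Z * l'%:Z
    - ((p ^ n')%:Z * c + (p ^ m)%:Z * c') =
  (p ^ n')%:Z * ((p ^ n)%:Z * l%:Z - (p ^ m)%:Z * t%:Z - c)
  + (p ^ m)%:Z * ((p ^ n')%:Z * t%:Z - (p ^ m')%:Z * l'%:Z - c').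
  by rewrite !expnD !PoszM; ring.
by rewrite rpredD // dvdz_mull.
Qed.

Lemma graph_span_star x : graph_span x -> graph_span (star x).
Proof.
elim=> [M hM|c y z _ hy _ hz]; first exact/graph_span_gen/graph_supported_star.
by rewrite starD starZ; apply: graph_span_lin.
Qed.

Lemma graph_spanM x y : graph_span x -> graph_span y -> graph_span (x * y).
Proof.
elim=> [M hM|c x1 x2 _ h1 _ h2] hy; last first.
  by rewrite mulrDl -scalerAl; apply: graph_span_lin; [apply: h1|apply: h2].
elim: hy => [M' hM'|c y1 y2 _ h1 _ h2].
  exact/graph_span_gen/graph_supportedM.
by rewrite mulrDr -scalerAr; apply: graph_span_lin.
Qed.

(** The limits of elements of [graph_span] form a C*-subalgebra, and it contains the
    generators. *)
Lemma graph_span_dense x (e : R) : 0 < e ->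
  exists2 y, graph_span y & cnorm (x - y) < e.
Proof.
move: e; pose D := [set x : Q | forall e : R, 0 < e ->
  exists2 y, graph_span y & cnorm (x - y) < e].
suff DT : D = setT by have : D x by rewrite DT.
have genD y : graph_supported y -> D y.
  move=> gy e e0; exists y; first exact: graph_span_gen.
  by rewrite subrr cnorm0.
have [_ gen _] := hQ; apply: gen; last 2 first.
- exact/genD/graph_supportedU.
- exact/genD/graph_supportedS.
split.
- exact/genD/graph_supported1.
- move=> c y z Dy Dz e e0.
  have nc : 0 <= Normc.normc c by case: c => a b /=; rewrite sqrtr_ge0.
  have c1 : 0 < Normc.normc c + 1 by lra.
  have [y' gy ny] := Dy (e / 2 / (Normc.normc c + 1)) (divr_gt0 (divr_gt0 e0 (ltr0n _ 2)) c1).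
  have [z' gz nz] := Dz (e / 2) (divr_gt0 e0 (ltr0n _ 2)).
  exists (c *: y' + z'); first exact: graph_span_lin.
  rewrite opprD addrACA -scalerBr.
  apply: le_lt_trans (ler_cnormD _ _) _; rewrite cnormZ.
  move: ny; rewrite ltr_pdivlMr //.
  by have := cnorm_ge0 (y - y'); nra.
- move=> y z Dy Dz e e0.
  have ny0 := cnorm_ge0 y.
  have y1 : 0 < cnorm y + 1 by lra.
  have [z' gz nz] := Dz (e / 2 / (cnorm y + 1)) (divr_gt0 (divr_gt0 e0 (ltr0n _ 2)) y1).
  have nz0 := cnorm_ge0 z'; have z1 : 0 < cnorm z' + 1 by lra.
  have [y' gy ny] := Dy (e / 2 / (cnorm z' + 1)) (divr_gt0 (divr_gt0 e0 (ltr0n _ 2)) z1).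
  exists (y' * z'); first exact: graph_spanM.
  have -> : y * z - y' * z' = y * (z - z') + (y - y') * z'.
    by rewrite mulrBr mulrBl addrA subrK.
  apply: le_lt_trans (ler_cnormD _ _) _.
  have := ler_cnormM y (z - z'); have := ler_cnormM (y - y') z'.
  move: ny nz; rewrite !ltr_pdivlMr //.
  by have := cnorm_ge0 (y - y'); have := cnorm_ge0 (z - z'); nra.
- move=> y Dy e e0; have [y' gy ny] := Dy e e0.
  by exists (star y'); [exact: graph_span_star|rewrite -starB cnorm_star].
- move=> v l Dv vl e e0.
  have e2 : 0 < e / 2 by lra.
  have /cvgrPdist_lt/(_ _ e2) [N _ /(_ N (leqnn N))] := vl.
  rewrite sub0r normrN ger0_norm ?cnorm_ge0 // => vN.
  have [y gy ny] := Dv N _ e2; exists y => //.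
  have -> : l - y = - (v N - l) + (v N - y) by rewrite opprB addrA subrK.
  by apply: le_lt_trans (ler_cnormD _ _) _; rewrite cnormN; lra.
Qed.

Context (k j : nat).
Hypothesis kp : coprime k p.
Hypothesis kj : ~~ (k %| j)%N.

(** Far out, [y] vanishes near the graph of the translation by the [p]-adic number
    [j / k]. *)
Definition avoids_translation (y : Q) := exists l0, forall l, (l0 <= l)%N ->
  exists N0, forall N, (N0 <= N)%N -> forall l',
    (k * l = k * l' + j %[mod p ^ N])%N -> P N l * y * P N l' = 0.

(** The line of [M] meets the graph of the translation where an affine function
    [a * l + b] with integer coefficients vanishes.  This function is not
    identically zero: otherwise [k] would divide [p ^ m * j].  So for large [l]
    it is a nonzero integer, and no high power of [p] divides it. *)
Lemma graph_supported_avoids M : graph_supported M -> avoids_translation M.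
Proof.
move=> [m [n [c MP]]].
pose a : int := k%:Z * ((p ^ n)%:Z - (p ^ m)%:Z).
pose b : int := (p ^ m)%:Z * j%:Z - k%:Z * c.
have ab : (a != 0) || (b != 0).
  rewrite -negb_and; apply: contra kj => /andP[_ /eqP b0].
  have : (k%:Z %| ((p ^ m) * j)%:Z)%Z.
    by rewrite PoszM -[X in (_ %| X)%Z](subrK (k%:Z * c)) -/b b0 add0r dvdz_mulr.
  by rewrite dvdzE /= Gauss_dvdr // coprimeXr.
(* If [a != 0] then [`|a * l| >= l > `|b|]; if [a = 0] the value is [b != 0]. *)
exists `|b|.+1 => l lb.
have ablN0 : a * l%:Z + b != 0.
  have [a0|a0] := eqVneq a 0.
    by rewrite a0 mul0r add0r; move: ab; rewrite a0 eqxx.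
  by have := a0; clear -lb a0; nia.
(* A nonzero integer [v] is not divisible by [p ^ N] once [`|v| <= N]. *)
exists (absz (a * l%:Z + b)) => N hN l' ll'.
apply: MP; apply: contra ablN0 => d1.
have d2 : ((p ^ N)%:Z %| k%:Z * l%:Z - k%:Z * l'%:Z - j%:Z)%Z.
  by rewrite -!PoszM -addrA -opprD -PoszD dvdz_subn; apply/eqP.
have : ((p ^ N)%:Z %| a * l%:Z + b)%Z.
  have -> : a * l%:Z + b =
    k%:Z * ((p ^ n)%:Z * l%:Z - (p ^ m)%:Z * l'%:Z - c)
    - (p ^ m)%:Z * (k%:Z * l%:Z - k%:Z * l'%:Z - j%:Z) by rewrite /a /b; ring.
  by rewrite rpredB // dvdz_mull.
rewrite /dvdz /= => d3; rewrite -absz_eq0; apply: contraT; rewrite -lt0n => pos.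
have := dvdn_leq pos d3; rewrite leqNgt.
by rewrite (leq_ltn_trans hN) // ltn_expl.
Qed.

Lemma graph_span_avoids y : graph_span y -> avoids_translation y.
Proof.
elim=> [|c x1 x2 _ [l1 h1] _ [l2 h2]]; first exact: graph_supported_avoids.
exists (maxn l1 l2) => l; rewrite geq_max => /andP[/h1 [N1 {}h1] /h2 [N2 {}h2]].
exists (maxn N1 N2) => N; rewrite geq_max => /andP[/h1 {}h1 /h2 {}h2] l' ll'.
rewrite mulrDr mulrDl -scalerAr -scalerAl (h1 _ ll') (h2 _ ll').
by rewrite scaler0 addr0.
Qed.

(** Such an [x] moves cylinders like the translation by [j / k].  Approximate it by
    some [y] in [graph_span], which is killed on a small cylinder: there [x] is
    small.  As [x] commutes with [U], it is equally small on all translates of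
    this cylinder, and the translates sum to [1]. *)
Lemma fractional_translation_eq0 x : U * x = x * U ->
  (forall N l l', (k * l = k * l' + j %[mod p ^ N])%N -> P N l * x = x * P N l') ->
  x = 0.
Proof.
move=> Ux Px; have [UU1 UU2 _ _ _] := (Qp_relationsE p U S).1 hrel.
(* Division by [k] is possible modulo [p ^ N]: this is [l - j / k]. *)
have partner N l : exists l', (k * l = k * l' + j %[mod p ^ N])%N.
  have pN : (0 < p ^ N)%N by rewrite expn_gt0 (leq_trans _ hp).
  have [a _] := Bezoutl k pN.
  have /eqP -> : coprime (p ^ N) k by rewrite coprime_sym coprimeXr.
  move=> /dvdnP [q aq]; exists (l + a * j)%N.
  have -> : (k * (l + a * j) + j = j * q * p ^ N + k * l)%N.
    by rewrite -mulnA -aq; ring.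
  by rewrite modnMDl.
have xUs t : star U ^+ t * x = x * star U ^+ t.
  elim: t => [|t IH]; first by rewrite mul1r mulr1.
  rewrite exprSr -mulrA.
  have -> : star U * x = x * star U.
    by rewrite -[x in LHS]mulr1 -UU2 !mulrA -[_ * x * U]mulrA -Ux mulrA UU1 mul1r.
  by rewrite mulrA IH -mulrA.
have small (e : R) : 0 < e -> cnorm x <= e.
  move=> e0; have [y /graph_span_avoids [l /(_ l (leqnn l)) [N /(_ N (leqnn N)) Py]]] :=
    graph_span_dense x e0.
  move=> xy; have [l' ll'] := partner N l.
  have nP t : cnorm (P N t) <= 1.
    by apply: cnorm_projection; rewrite ?cyl_star ?(cyl_idem hrel).
  have nl : cnorm (P N l * x) <= e.
    have -> : P N l * x = P N l * (x - y) * P N l'.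
      rewrite mulrBr mulrBl Py // subr0 -mulrA -(Px _ _ _ ll') mulrA.
      by rewrite (cyl_idem hrel).
    apply: le_trans (ler_cnormM _ _) _; apply: le_trans (ltW xy).
    apply: le_trans (_ : cnorm (P N l * (x - y)) * 1 <= _).
      by rewrite ler_wpM2l ?cnorm_ge0.
    rewrite mulr1; apply: le_trans (ler_cnormM _ _) _.
    by rewrite ler_piMl ?cnorm_ge0.
  have nt t : cnorm (P N (t + l) * x) <= e.
    have -> : P N (t + l) * x = U ^+ t * (P N l * x) * star U ^+ t.
      rewrite -!mulrA -xUs mulrA (UX_cyl hrel) !mulrA -[_ * U ^+ t * _]mulrA.
      by rewrite (UXstarU hrel) mulr1.
    have nU : cnorm (U ^+ t) <= 1.
      by apply: cnorm_isometry; rewrite starX (starUXU hrel).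
    apply: le_trans (ler_cnormM _ _) _; rewrite -starX cnorm_star.
    apply: le_trans nl; apply: le_trans (_ : cnorm (U ^+ t * (P N l * x)) * 1 <= _).
      by rewrite ler_wpM2l ?cnorm_ge0.
    rewrite mulr1; apply: le_trans (ler_cnormM _ _) _.
    by rewrite ler_piMl ?cnorm_ge0.
  rewrite -(@ler_pXn2r _ 2) ?nnegrE ?cnorm_ge0 ?(ltW e0) // -cnorm_star -cnorm_star_mul.
  rewrite starK.
  apply: (@cnorm_block_diag _ _ _ (fun t : 'I_(p ^ N) => P N (t + l))).
  - by move=> t; rewrite (cyl_idem hrel).
  - transitivity (U ^+ l * (\sum_(t < p ^ N) P N t) * star U ^+ l).
      rewrite mulr_sumr mulr_suml; apply: eq_bigr => t _.
      by rewrite (UX_cyl hrel) addnC -mulrA (UXstarU hrel) mulr1.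
    by rewrite (sum_cyl hrel) mulr1 (UXstarU hrel).
  - by rewrite starM starK.
  - move=> t; have [t' tt'] := partner N (t + l)%N.
    rewrite mulrA (Px _ _ _ tt') -!mulrA; congr (_ * _).
    apply: (can_inj (@starK _ Q)); rewrite !starM !starK !cyl_star.
    exact: Px.
  - move=> t; have [t' tt'] := partner N (t + l)%N.
    have -> : P N (t + l) * (x * star x) =
              (P N (t + l) * x) * star (P N (t + l) * x).
      rewrite {2}(Px _ _ _ tt') starM cyl_star !mulrA.
      by rewrite -[P N _ * x * P N t']mulrA -(Px _ _ _ tt') mulrA (cyl_idem hrel).
    apply: le_trans (ler_cnormM _ _) _; rewrite cnorm_star -expr2.
    by rewrite ler_pXn2r ?nnegrE ?cnorm_ge0 ?(ltW e0).
  - by rewrite exprn_ge0 ?(ltW e0).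
apply: cnorm0_eq0; apply/eqP; rewrite eq_le cnorm_ge0 andbT leNgt.
by apply/negP => x0; have := small _ (divr_gt0 x0 (ltr0n _ 2)); lra.
Qed.

End GraphSpan.

(** * Uniqueness of the conditional expectation and the index *)

Section Uniqueness.
Context {R : realType} (p : nat) (Q : cstarType R) (U S : Q).
Hypothesis hp : (2 <= p)%N.
Hypothesis hQ : is_Qp p U S.
Context (k : nat) (chi : Q -> Q).
Hypothesis kp : coprime k p.
Hypothesis hchi : star_hom chi.
Hypothesis chiU : chi U = U ^+ k.
Hypothesis chiS : chi S = S.

Let hrel : Qp_relations p U S. Proof. by case: hQ. Qed.
Local Notation P := (cyl U S).

Lemma chi_cyl N l : chi (P N l) = P N (k * l).
Proof.
have E : chi (cyl_iso U S N l) = cyl_iso U S N (k * l).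
  by rewrite !cyl_isoE (star_homM hchi) !(star_homX hchi) chiU chiS exprM.
by rewrite !cylE (star_homM hchi) (star_hom_star hchi) E.
Qed.

(** The range of [chi] contains [U ^+ k] and every cylinder projection, so the
    module property transfers to the value at [U ^+ j] the commutation rules of
    [U ^+ j] with these elements; read through [chi], they are those of
    [fractional_translation_eq0]. *)
Lemma cond_exp_UX (E : Q -> Q) j : injective chi ->
  faithful_cond_exp (range chi) E -> ~~ (k %| j)%N -> E (U ^+ j) = 0.
Proof.
move=> chi_inj [_ [Erange _] Emod _ _] kj.
have r1 : range chi 1 by exists 1 => //; rewrite (star_hom1 hchi).
have Eml a x : E (chi a * x) = chi a * E x.
  by have := Emod (chi a) x 1; rewrite !mulr1; apply => //; exists a.
have Emr x b : E (x * chi b) = E x * chi b.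
  by have := Emod 1 x (chi b); rewrite !mul1r; apply => //; exists b.
have [x _ Ex] := Erange (U ^+ j); rewrite -Ex.
rewrite (@fractional_translation_eq0 _ p Q U S hp hQ k j kp kj x).
- exact: star_hom0.
- apply: chi_inj; rewrite !(star_homM hchi) Ex -Eml -Emr chiU.
  by rewrite -!exprD addnC.
- move=> N l l' ll'; apply: chi_inj; rewrite !(star_homM hchi) Ex -Eml -Emr.
  by rewrite !chi_cyl (UX_cyl hrel) addnC (eq_cyl hrel ll').
Qed.

End Uniqueness.

Section NatIndex.
Context {R : realType} (p : nat) (Q : cstarType R) (U S : Q).
Hypothesis hp : (2 <= p)%N.
Hypothesis hQ : is_Qp p U S.

Let hrel : Qp_relations p U S. Proof. by case: hQ. Qed.

(** Since the [U ^+ j] form a quasi-basis for [twisted_exp] and every expectation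
    kills them for [0 < j < k], the expectation is unique, and the infimum is
    over one value. *)
Lemma watatani_index_nat (k : nat) (chi : Q -> Q) :
  (0 < k)%N -> coprime k p -> star_hom chi -> chi U = U ^+ k -> chi S = S ->
  watatani_index (range chi) = (k%:R)%:E.
Proof.
move=> k0 kp hchi chiU chiS.
have kn : (k <= p ^ k)%N by apply: ltnW; apply: ltn_expl.
have [_ _ univ] := hQ.
have [rho [[hrho rhoU rhoS] _]] := univ Q _ _ (root_relations hp hrel k0 kp kn).
pose E := twisted_exp U S k k chi rho.
have hE : faithful_cond_exp (range chi) E.
  exact: (twisted_exp_cond hp hQ k0 kp kn hchi chiU chiS hrho rhoU rhoS).
have rangeE x : range chi (E x) by case: hE => _ [].
have indexE : has_index E (real_complex R k%:R *: 1).
  exact: (twisted_index hp hQ k0 kp kn hchi chiU chiS hrho rhoU rhoS).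
have chi_inj : injective chi.
  exact: can_inj (chiK hp hQ k0 kn hchi chiU chiS hrho rhoU rhoS).
have uniqE F : faithful_cond_exp (range chi) F -> F = E.
  move=> hF; have [linF [_ idF] modF _ _] := hF.
  have r1 : range chi 1 by exists 1 => //; rewrite (star_hom1 hchi).
  have FD x y : F (x + y) = F x + F y.
    by have := linF 1 x y; rewrite !scale1r.
  have F0 : F 0 = 0 by apply: (@addrI _ (F 0)); rewrite -FD !addr0.
  apply/funext => x.
  rewrite {1}(twisted_expansion hp hQ k0 kp kn hchi chiU chiS hrho rhoU rhoS x).
  rewrite (big_morph F FD F0) (bigD1 (Ordinal k0)) //= big1 => [|j j0].
    rewrite expr0 star1 !mul1r addr0; exact/idF/rangeE.
  have := modF 1 (U ^+ j) (E (star (U ^+ j) * x)) r1; rewrite !mul1r => -> //.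
  rewrite (cond_exp_UX hp hQ kp hchi chiU chiS chi_inj hF) ?mul0r //.
  rewrite gtnNdvd // lt0n; apply: contra j0 => /eqP j0.
  exact/eqP/val_inj.
rewrite /watatani_index [X in ereal_inf X](_ : _ = [set (k%:R)%:E]) ?ereal_inf1 //.
apply/seteqP; split=> [_ [r [F [hF]] + <-]|_ ->] /=; last first.
  by exists k%:R => //; exists E.
rewrite (uniqE F hF) => /(has_index_unique indexE) => Er.
suff -> : r = k%:R by [].
have : real_complex R (k%:R - r) *: (1 : Q) = 0.
  by rewrite rmorphB scalerBl Er subrr.
move/eqP; rewrite scaler_eq0 oner_eq0 orbF => /eqP/(congr1 (@complex.Re R)) /=.
by move/eqP; rewrite subr_eq0 => /eqP ->.
Qed.

Lemma flip_relations : Qp_relations p (star U) S.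
Proof.
have [UU1 UU2 SS SU sum1] := (Qp_relationsE p U S).1 hrel.
apply/Qp_relationsE; split; rewrite ?starK //.
  transitivity (star U ^+ p * (U ^+ p * S) * star U).
    by rewrite mulrA (starUXU hrel) mul1r.
  by rewrite -SU -!mulrA UU2 mulr1.
have [q pq] : exists q, p = q.+1 by exists p.-1; rewrite prednK // ltnW.
have <- : star U ^+ q * (\sum_(l < p) U ^+ l * S * star S * star U ^+ l) * U ^+ q = 1.
  by rewrite sum1 mulr1 (starUXU hrel).
rewrite mulr_sumr mulr_suml (reindex_inj rev_ord_inj) /=.
apply: eq_bigr => l _; have lq : (l <= q)%N by rewrite -ltnS -pq.
have -> : (p - l.+1 = q - l)%N by rewrite {1}pq subSS.
have starU_U : star U ^+ q * U ^+ l = star U ^+ (q - l).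
  by rewrite -{1}(subnK lq) exprD -mulrA (starUXU hrel) mulr1.
have starU_U' : star U ^+ l * U ^+ q = U ^+ (q - l).
  by rewrite -{1}(subnKC lq) exprD mulrA (starUXU hrel) mul1r.
by rewrite !mulrA starU_U -[RHS]mulrA starU_U'.
Qed.

End NatIndex.

Lemma PoszX (m i : nat) : m%:Z ^+ i = (m ^ i)%:Z.
Proof. by elim: i => [|i IH]; rewrite ?expr0 // exprS expnS PoszM IH. Qed.

Theorem theorem4p5 (R : realType) (p : nat) (hp : (2 <= p)%N)
    (Q : cstarType R) (U S : Q) (hQ : is_Qp p U S)
    (i : nat) (k : int)
    (hk : k = (p%:Z - 1) ^+ i \/ k = - (p%:Z - 1) ^+ i)
    (chi : Q -> Q) (hchi : is_chi U S k chi) :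
  watatani_index (range chi) = (`|k|%:~R)%:E.
Proof.
have [star_chi chiU chiS] := hchi.
pose K := (p.-1 ^ i)%N.
have KE : (p%:Z - 1) ^+ i = K%:Z.
  by rewrite subzn ?(ltnW hp) // PoszX subn1.
have K0 : (0 < K)%N by rewrite expn_gt0 -ltnS prednK ?hp // ltnW.
have Kp : coprime K p by rewrite coprimeXl // coprimePn // ltnW.
have absk : `|k| = K%:Z by case: hk => ->; rewrite KE ?normrN.
rewrite absk -pmulrn.
case: hk => kE; rewrite kE KE in chiU.
  exact: (watatani_index_nat hp hQ K0 Kp star_chi).
have [hrel _ univ] := hQ.
have [tau [[star_tau tauU tauS] _]] := univ Q _ _ (flip_relations hp hQ).
have tauK : tau \o tau = id.
  apply: (Qp_hom_unique hQ).
  - exact: star_hom_comp.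
  - exact: star_hom_id.
  - by rewrite /= tauU (star_hom_star star_tau) tauU starK.
  - by rewrite /= !tauS.
have -> : range chi = range (chi \o tau).
  apply/seteqP; split=> [_ [x _ <-]|_ [x _ <-]]; last by exists (tau x).
  by exists (tau x) => //=; rewrite -[tau (tau x)]/((tau \o tau) x) tauK.
apply: (watatani_index_nat hp hQ K0 Kp) => /=.
- exact: star_hom_comp.
- by rewrite tauU (star_hom_star star_chi) chiU upowN starX starK.
- by rewrite tauS.
Qed.
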